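(* Let $\mathcal{A}$ be an arrangement in $V=\mathbb{K}^\ell$, $H\in\mathcal{A}$, $\mathcal{A}'=\mathcal{A}\setminus\{H\}$, $0\le p\le\ell$, and assume $\Omega^p(\mathcal{A}')$ is a free $S$-module. If $\Omega^p(\mathcal{A})$ is not free, then there exist $\omega_1,\dots,\omega_s\in\Omega^p(\mathcal{A})$ such that $\operatorname{res}^p(\omega_1),\dots,\operatorname{res}^p(\omega_s)$ form a minimal set of generators of $\Omega^{p-1}(\mathcal{A}^H)/\overline{B}$ and $$\Omega^p(\mathcal{A})=\Omega^p(\mathcal{A}')+\sum_{i=1}^sS\omega_i;$$ moreover $\operatorname{pd}_S\Omega^p(\mathcal{A})=\operatorname{pd}_{\overline{S}}\Omega^{p-1}(\mathcal{A}^H)+1$. In particular, if $\Omega^p(\mathcal{A}')$ and $\Omega^{p-1}(\mathcal{A}^H)$ are both free, then $\operatorname{pd}_S\Omega^p(\mathcal{A})\le1$.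
   Context: $\mathbb{K}$ a field, $S=\mathbb{K}[x_1,\dots,x_\ell]$. For an arrangement (finite set of linear hyperplanes) $\mathcal{A}$, $\alpha_H$ is a defining linear form, $Q(\mathcal{A})=\prod\alpha_H$. $\Omega^p_V=\bigoplus_{i_1<\dots<i_p}S\,dx_{i_1}\wedge\dots\wedge dx_{i_p}$, $\Omega^p(\mathcal{A})=\{\omega\in\frac1{Q(\mathcal{A})}\Omega^p_V: Q(\mathcal{A})\omega\wedge d\alpha_H\in\alpha_H\Omega^{p+1}_V\ \forall H\in\mathcal{A}\}$. Choose coordinates with $x_1=\alpha_H$; $\overline{S}=S/x_1S$; $\mathcal{A}^H=\{L\cap H:L\in\mathcal{A}'\}$, with $\Omega^q(\mathcal{A}^H)$ defined analogously over $\overline{S}$ ($\Omega^{-1}:=0$). Every $\omega\in\Omega^p(\mathcal{A})$ can be written $\omega=\omega_0\wedge\frac{dx_1}{x_1}+\omega_1$ with $\omega_0,\omega_1$ rational forms not involving $dx_1$ and with coefficient denominators not divisible by $x_1$; $\operatorname{res}^p(\omega)=\overline{\omega_0}$ (coefficients reduced mod $x_1$). $\overline{B}=\overline{Q(\mathcal{A}')}/Q(\mathcal{A}^H)\in\overline{S}$ ($Q(\mathcal{A}^H)$ the product of defining forms of $\mathcal{A}^H$), and $\Omega^{p-1}(\mathcal{A}^H)/\overline{B}=\{\eta/\overline{B}:\eta\in\Omega^{p-1}(\mathcal{A}^H)\}$. The map $\operatorname{res}^p$ sends $\Omega^p(\mathcal{A})$ into $\Omega^{p-1}(\mathcal{A}^H)/\overline{B}$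 with kernel $\Omega^p(\mathcal{A}')$. *)

(* Defs.v *)
From Stdlib Require Import ClassicalEpsilon.
From HB Require Import structures.
From mathcomp Require Import all_boot all_order all_algebra.
From mathcomp Require Import finmap ring.
From mathcomp.multinomials Require Import mpoly.

Set Implicit Arguments.
Unset Strict Implicit.
Unset Printing Implicit Defensive.

Import GRing.Theory.

Local Open Scope ring_scope.

(* Submodules of a module W are represented by predicates W -> Prop. *)
Section Modules.
Variable R : comNzRingType.

Definition is_basis (W : lmodType R) (M B : W -> Prop) : Prop :=
  [/\ forall v, B v -> M v,
      forall w, M w -> exists (s : seq W) (c : W -> R),
        (forall v, v \in s -> B v) /\ w = \sum_(v <- s) c v *: v
    & forall (s : seq W) (c : W -> R), uniq s -> (forall v, v \in s -> B v) ->
        \sum_(v <- s) c v *: v = 0 -> forall v, v \in s -> c v = 0].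

Definition free_submod (W : lmodType R) (M : W -> Prop) : Prop :=
  exists B : W -> Prop, is_basis M B.

Definition generates (W : lmodType R) (M : W -> Prop) (s : nat)
    (g : 'I_s -> W) : Prop :=
  forall w, M w <-> exists c : 'I_s -> R, w = \sum_i c i *: g i.

(* Both usual senses of minimality are required: no proper subfamily generates,
   and no generating family has fewer members. They agree for homogeneous
   generators of a graded module; for arbitrary elements the first alone is
   weaker (e.g. {x, 1 - x} generates K[x]). *)
Definition minimal_generators (W : lmodType R) (M : W -> Prop) (s : nat)
    (g : 'I_s -> W) : Prop :=
  [/\ generates M g,
      forall J : {set 'I_s}, J \proper [set: 'I_s] ->
        ~ (forall w, M w -> exists c : 'I_s -> R, w = \sum_(i in J) c i *: g i)
    & forall (t : nat) (h : 'I_t -> W), generates M h -> (s <= t)%N].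

Definition projective (P : lmodType R) : Prop :=
  forall (M N : lmodType R) (f : {linear M -> N}) (g : {linear P -> N}),
    (forall y, exists x, f x = y) ->
    exists h : {linear P -> M}, forall u, f (h u) = g u.

(* A projective resolution 0 -> P_n -> ... -> P_0 -> M -> 0. *)
Definition proj_resolution (W : lmodType R) (M : W -> Prop) (n : nat)
    (P : nat -> lmodType R) (d : forall i, {linear P i.+1 -> P i})
    (eps : {linear P 0%N -> W}) : Prop :=
  [/\ forall i, projective (P i),
      forall w, M w <-> exists u, eps u = w,
      forall u, eps u = 0 <-> exists v, d 0%N v = u,
      forall i u, d i u = 0 <-> exists v, d i.+1 v = u
    & forall i (u : P i), (n < i)%N -> u = 0].

Definition pd_le (W : lmodType R) (M : W -> Prop) (n : nat) : Prop :=
  exists P d eps, @proj_resolution W M n P d eps.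

Definition is_pd (W : lmodType R) (M : W -> Prop) (d : option nat) : Prop :=
  match d with
  | Some n => pd_le M n /\ forall k, pd_le M k -> (n <= k)%N
  | None => forall k, ~ pd_le M k
  end.

(* Projective dimension, with None standing for infinity. *)
Definition pd (W : lmodType R) (M : W -> Prop) : option nat :=
  epsilon (inhabits None) (is_pd M).

Lemma pdP (W : lmodType R) (M : W -> Prop) : is_pd M (pd M).
Proof.
apply: epsilon_spec; case: (classic (exists n, pd_le M n)) => [[n]|h]; last first.
  by exists None => k Mk; apply: h; exists k.
elim/ltn_ind: n => n IH Mn.
case: (classic (exists2 k, (k < n)%N & pd_le M k)) => [[k kn Mk]|h].
  exact: IH Mk.
exists (Some n); split=> // k Mk; rewrite leqNgt; apply/negP => kn.
by apply: h; exists k.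
Qed.

End Modules.

Section FracModule.
Variable R : idomainType.

Definition frac_scale (a : R) (f : {fraction R}) : {fraction R} :=
  FracField.tofrac a * f.

Fact frac_scaleA a b f :
  frac_scale a (frac_scale b f) = frac_scale (a * b) f.
Proof. by rewrite /frac_scale rmorphM mulrA. Qed.
Fact frac_scale1 : left_id 1 frac_scale.
Proof. by move=> f; rewrite /frac_scale rmorph1 mul1r. Qed.
Fact frac_scaleDr : right_distributive frac_scale +%R.
Proof. by move=> a f g; rewrite /frac_scale mulrDr. Qed.
Fact frac_scaleDl f : {morph frac_scale^~ f : a b / a + b}.
Proof. by move=> a b; rewrite /frac_scale rmorphD mulrDl. Qed.

HB.instance Definition _ := GRing.Zmodule_isLmodule.Build R {fraction R}
  frac_scaleA frac_scale1 frac_scaleDr frac_scaleDl.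

End FracModule.

Section Forms.
Variables (K : fieldType) (m : nat).
Local Notation S := {mpoly K[m]}.

(* The value at I = {i_1 < ... < i_p} is the coefficient of
   dx_{i_1} /\ ... /\ dx_{i_p}. *)
Definition rform := {ffun {set 'I_m} -> {fraction S}}.

(* dx_I /\ dx_J = wedge_sign I J dx_(I u J) for disjoint I and J. *)
Definition wedge_sign (I J : {set 'I_m}) : {fraction S} :=
  (-1) ^+ #|[set ij in setX I J | (ij.2 < ij.1)%N]|.

Definition wedge (u v : rform) : rform :=
  [ffun I : {set 'I_m} =>
     \sum_(J : {set 'I_m} | J \subset I)
        wedge_sign J (I :\: J) * u J * v (I :\: J)].

Definition fdx (f : {fraction S}) (i : 'I_m) : rform :=
  [ffun I => if I == [set i] then f else 0].

Definition dpoly (f : S) : rform :=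
  \sum_(i < m) fdx (FracField.tofrac f^`M(i)) i.

(* Omega^p_V. The degree is an integer, so that degree -1 gives the zero
   module. *)
Definition regular_form (p : int) (w : rform) : Prop :=
  (forall I : {set 'I_m}, #|I|%:Z != p -> w I = 0) /\
  (forall I : {set 'I_m}, exists f : S, w I = FracField.tofrac f).

Definition form_div (M : rform -> Prop) (b : {fraction S}) (w : rform) : Prop :=
  exists2 eta, M eta & w = [ffun I => eta I / b].

Variable T : choiceType.

Definition Qpoly (A : {fset T}) (alpha : T -> S) : S :=
  \prod_(L <- A) alpha L.

Definition Omega (A : {fset T}) (alpha : T -> S) (p : int) (w : rform) : Prop :=
  regular_form p (Qpoly A alpha *: w) /\
  forall L, L \in A -> exists2 eta, regular_form (p + 1) eta
    & wedge (Qpoly A alpha *: w) (dpoly (alpha L)) = alpha L *: eta.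

End Forms.

Section Residue.
Variables (K : fieldType) (n : nat).
Local Notation S := {mpoly K[n.+1]}.
Local Notation Sbar := {mpoly K[n]}.

(* The projection S -> S/x_1 S, with S/x_1 S identified with K[x_2, ..., x_l];
   the variable x_1 has index ord0, and x_(j+2) becomes the j-th variable. *)
Definition mred (f : S) : Sbar :=
  f \mPo [tuple (if unlift ord0 i is Some j then 'X_j else 0) | i < n.+1].

Lemma mredX (i : 'I_n.+1) :
  mred ('X_i : S) = if unlift ord0 i is Some j then 'X_j else 0.
Proof. by rewrite /mred comp_mpolyXU -tnth_nth tnth_mktuple. Qed.

Lemma mredM (f g : S) : mred (f * g) = mred f * mred g.
Proof. by rewrite /mred rmorphM. Qed.

Let mlift (g : Sbar) : S := g \mPo [tuple 'X_(lift ord0 j) | j < n].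

Let mred_split (f : S) : exists c, f = mlift (mred f) + 'X_ord0 * c.
Proof.
have splitM (f1 f2 : S) : (exists c, f1 = mlift (mred f1) + 'X_ord0 * c) ->
    (exists c, f2 = mlift (mred f2) + 'X_ord0 * c) ->
    exists c, f1 * f2 = mlift (mred (f1 * f2)) + 'X_ord0 * c.
  move=> [c1 E1] [c2 E2]; exists (c1 * f2 + mlift (mred f1) * c2).
  rewrite mredM /mlift rmorphM /= -/(mlift _) -/(mlift _).
  rewrite [in LHS]E1 [in LHS]E2 [X in c1 * X]E2; ring.
have split1 : exists c, (1 : S) = mlift (mred 1) + 'X_ord0 * c.
  by exists 0; rewrite /mlift /mred !rmorph1 mulr0 addr0.
elim/mpolyind: f => [|a m f _ _ [c E]].
  by exists 0; rewrite /mlift /mred !raddf0 mulr0 addr0.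
have [c' E'] : exists c, ('X_[m] : S) = mlift (mred 'X_[m]) + 'X_ord0 * c.
  rewrite mpolyXE_id; elim/big_ind: _ => // i _.
  elim: (m i) => [|k IH]; first by rewrite expr0.
  rewrite exprS; apply: splitM IH; rewrite mredX.
  case: unliftP => [j|] ->.
    by exists 0; rewrite /mlift comp_mpolyXU -tnth_nth tnth_mktuple mulr0 addr0.
  by exists 1; rewrite /mlift raddf0 add0r mulr1.
exists (a *: c' + c); rewrite /mlift /mred !linearP /= -/(mred _) -/(mlift _).
rewrite -/(mred f) -/(mlift (mred f)) {1}E {1}E'.
by rewrite scalerDr mulrDr scalerAr addrACA.
Qed.

(* The kernel of mred is x_1 S. *)
Lemma mred_eq0P (f : S) : mred f = 0 <-> exists c, f = 'X_ord0 * c.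
Proof.
split=> [f0|[c ->]]; last by rewrite mredM mredX unlift_none mul0r.
by have [c] := mred_split f; rewrite f0 /mlift raddf0 add0r; exists c.
Qed.

(* f lies in the localization of S at (x_1) and reduces to g. *)
Definition reduces_to (f : {fraction S}) (g : {fraction Sbar}) : Prop :=
  exists a b : S,
    [/\ ~ (exists c, b = 'X_ord0 * c),
        f = FracField.tofrac a / FracField.tofrac b
      & g = FracField.tofrac (mred a) / FracField.tofrac (mred b)].

Definition no_dx1_x1_regular (w : rform K n.+1) : Prop :=
  (forall I : {set 'I_n.+1}, ord0 \in I -> w I = 0) /\
  (forall I : {set 'I_n.+1}, exists g, reduces_to (w I) g).

Definition is_residue (w : rform K n.+1) (eta : rform K n) : Prop :=
  exists w0 w1 : rform K n.+1,
    [/\ no_dx1_x1_regular w0, no_dx1_x1_regular w1,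
        w = wedge w0 (fdx (FracField.tofrac 'X_ord0)^-1 ord0) + w1
      & forall J : {set 'I_n}, reduces_to (w0 (lift ord0 @: J)) (eta J)].

Lemma reduces_to_uniq (f : {fraction S}) (g g' : {fraction Sbar}) :
  reduces_to f g -> reduces_to f g' -> g = g'.
Proof.
have divE (F : fieldType) (a b c d : F) :
    b != 0 -> d != 0 -> a / b = c / d -> a * d = c * b.
  by move=> b0 d0 /eqP; rewrite eqr_div // => /eqP.
have Ediv (F : fieldType) (a b c d : F) :
    b != 0 -> d != 0 -> a * d = c * b -> a / b = c / d.
  by move=> b0 d0 E; apply/eqP; rewrite eqr_div //; apply/eqP.
have tofrac_inj (R : idomainType) : injective (@FracField.tofrac R).
  by move=> u v /eqP; rewrite tofrac_eq => /eqP.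
have nz (b : S) : ~ (exists c, b = 'X_ord0 * c) ->
    FracField.tofrac b != 0 /\ FracField.tofrac (mred b) != 0.
  rewrite !tofrac_eq0 => nb; split; apply/eqP.
    by move=> b0; apply: nb; exists 0; rewrite mulr0.
  by move/mred_eq0P.
move=> [a [b [/nz[b0 rb0] -> ->]]] [a' [b' [/nz[b0' rb0'] E ->]]].
have {}E : a * b' = a' * b.
  by apply: tofrac_inj; rewrite !tofracM; exact: (divE _ _ _ _ _ b0 b0' E).
apply: (Ediv _ _ _ _ _ rb0 rb0').
by rewrite -!tofracM -!mredM E.
Qed.

Lemma is_residue_uniq (w : rform K n.+1) (eta eta' : rform K n) :
  is_residue w eta -> is_residue w eta' -> eta = eta'.
Proof.
pose x := (FracField.tofrac ('X_ord0 : S))^-1.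
have x0 : x != 0.
  rewrite invr_eq0 tofrac_eq0; apply/eqP => /(congr1 (fun f : S => f@_U_(ord0))).
  by rewrite mcoeffX eqxx mcoeff0 => /eqP; rewrite oner_eq0.
have coefE (w0 w1 : rform K n.+1) (J : {set 'I_n}) : no_dx1_x1_regular w1 ->
    (wedge w0 (fdx x ord0) + w1) (ord0 |: lift ord0 @: J) =
    wedge_sign K (lift ord0 @: J) [set ord0] * x * w0 (lift ord0 @: J).
  move=> [w1_0 _]; set I := lift ord0 @: J.
  have I0 : ord0 \notin I.
    by apply/imsetP => -[j _ /eqP]; rewrite (negPf (neq_lift _ _)).
  rewrite !ffunE w1_0 ?setU11 // addr0 (bigD1 I) ?subsetUr //= big1 => [|L].
    have -> : (ord0 |: I) :\: I = [set ord0].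
      by rewrite setDUl setDv setU0; apply/setDidPl; rewrite disjoints1.
    by rewrite ffunE eqxx addr0 mulrAC.
  case/andP=> sL nL; rewrite ffunE ifN ?mulr0 //; apply: contra nL => /eqP E.
  by rewrite -(setIidPr sL) -[_ :&: _]set0U -{1}(setDv (ord0 |: I)) -setDDr E setU1K.
move=> [w0 [w1 [_ h1 -> r]]] [w0' [w1' [_ h1' E r']]].
apply/ffunP => J; have := congr1 (fun f : rform K n.+1 => f (ord0 |: lift ord0 @: J)) E.
rewrite !coefE // => E'.
have EJ : w0 (lift ord0 @: J) = w0' (lift ord0 @: J).
  by apply: mulfI E'; apply: mulf_neq0 x0; rewrite signr_eq0.
by have := r' J; rewrite -EJ => rJ; exact: reduces_to_uniq (r J) rJ.
Qed.

(* Meaningful when w admits such a decomposition; junk otherwise. *)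
Definition res (w : rform K n.+1) : rform K n :=
  epsilon (inhabits 0) (is_residue w).

End Residue.

Section Arrangement.
Variables (K : fieldType) (V : vectType K).

(* f is a linear form in m variables which, in terms of the coordinates x on
   the subspace U, defines the subspace L of U. *)
Definition defining_form (m : nat) (U : {vspace V}) (x : V -> 'I_m -> K)
    (L : {vspace V}) (f : {mpoly K[m]}) : Prop :=
  f \is 1.-homog /\ forall v, v \in U -> (v \in L) = (f.@[x v] == 0).

Definition deletion (A : {fset {vspace V}}) (H : {vspace V}) :
    {fset {vspace V}} := (A `\ H)%fset.

Definition restriction (A : {fset {vspace V}}) (H : {vspace V}) :
    {fset {vspace V}} := [fset (L :&: H)%VS | L in deletion A H]%fset.

Definition Bbar (n : nat) (A : {fset {vspace V}}) (H : {vspace V})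
    (alpha : {vspace V} -> {mpoly K[n.+1]}) (beta : {vspace V} -> {mpoly K[n]}) :
    {fraction {mpoly K[n]}} :=
  FracField.tofrac (mred (Qpoly (deletion A H) alpha)) /
  FracField.tofrac (Qpoly (restriction A H) beta).

End Arrangement.

(* Main.v *)
Require Import Defs.
From Stdlib Require Import ClassicalEpsilon FunctionalExtensionality.
From HB Require Import structures.
From mathcomp Require Import all_boot all_order all_algebra.
From mathcomp Require Import finmap ring.
From mathcomp.multinomials Require Import mpoly.

Set Implicit Arguments.
Unset Strict Implicit.
Unset Printing Implicit Defensive.

Import GRing.Theory.
Local Open Scope ring_scope.

(* Write M' = Omega^p(A'), M = Omega^p(A), N = Omega^(p-1)(A^H) / Bbar and x = x_1.

   The residue is always onto N when M' is free.  Given eta in N and X in A^H,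
   let zeta be the numerator of eta and zeta /\ d beta_X = beta_X kappa; then
   zeta /\ dx - x kappa is logarithmic along every hyperplane through X, so the
   product of the alpha_L with L /\ H <> X multiplies eta into res M.  If F, G
   are coprime products of forms alpha_L with coprime reductions and F eta =
   res u, G eta = res v, then G u - F v lies in M' and x (G u - F v) in
   (F, G) M'; as M' is free and F, G, x is a regular sequence, G u - F v =
   G m_1 - F m_2 with m_i in M', and w = (u - m_1) / F = (v - m_2) / G is in M
   with res w = eta.  Removing the elements X of A^H one by one gives the claim.

   For the projective dimensions, let R^q = M', let Rb^r -> N be onto with kernel
   Z (R = K[x_1, ..., x_l], Rb = R / x R).  The kernel of a lift R^q + R^r -> M is
   {u in R^r | u mod x in Z}, an extension of Z by x R^r of the same shape, so
   Schanuel's lemma and induction give pd_R M <= k + 1 iff pd_Rb N <= k.  Finally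
   M is graded, so that it is free as soon as it is projective. *)

(** Several hyperplanes of A' may cut H in the same X. Their forms agree mod x up to scalars, so
    their products cannot be separated by coprime reductions. This is why the factors are grouped by
    X, and why each X needs a lift that is logarithmic along all hyperplanes above it at once; kappa
    provides it.

    Rational forms are treated through their numerators: the logarithmic conditions become
    divisibilities between polynomials, the residue of t / (x Q') becomes the reduction of the
    dx_1-part of t, and degrees are plain polynomial degrees.

    The comparison of projective dimensions is an equivalence between bounds, so that infinite
    dimension needs no separate treatment. Its base case uses no Ext: one direction is a computation
    with an idempotent, the other a division by x. Non-freeness of M serves to exclude projective
    dimension 0, which is not a successor. *)

Section Submodules.
Variables (R : comNzRingType) (W : lmodType R).
Implicit Types M : W -> Prop.

Definition submod M : Prop :=
  M 0 /\ forall a u v, M u -> M v -> M (a *: u + v).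

(** Maps out of a submodule are total functions on the ambient module, with arbitrary values off
    [M]; no subtype has to be mentioned. *)
Definition linear_on (X : lmodType R) M (h : W -> X) : Prop :=
  forall a u v, M u -> M v -> h (a *: u + v) = a *: h u + h v.

Section Sub.
Variables (M : W -> Prop) (hM : submod M).

(** Deciding [M] classically gives the boolean predicate on which the library builds a submodule.
    The proof of closure is an argument, so that instances can be inferred from the predicate. *)
Definition sub_pred (_ : submod M) : {pred W} :=
  fun w => if excluded_middle_informative (M w) then true else false.

Lemma sub_predP w : reflect (M w) (w \in sub_pred hM).
Proof.
by rewrite unfold_in; case: excluded_middle_informative => ?; constructor.
Qed.

Fact sub_pred_closed : submod_closed (sub_pred hM).
Proof.
split; first by apply/sub_predP; case: hM.
by move=> a u v /sub_predP Mu /sub_predP Mv; apply/sub_predP; apply: hM.2.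
Qed.

HB.instance Definition _ :=
  GRing.isSubmodClosed.Build R W (sub_pred hM) sub_pred_closed.

Record sub_lmod := SubLmod { sub_val :> W; sub_valP : sub_val \in sub_pred hM }.

HB.instance Definition _ := [isSub for sub_val].
HB.instance Definition _ := [Choice of sub_lmod by <:].
HB.instance Definition _ := [SubChoice_isSubLmodule of sub_lmod by <:].

Lemma sub_valM (u : sub_lmod) : M (val u).
Proof. by apply/sub_predP; case: u. Qed.

Definition in_sub w (Mw : M w) : sub_lmod := SubLmod (introT (sub_predP w) Mw).

End Sub.

Lemma submodZ M a u : submod M -> M u -> M (a *: u).
Proof. by move=> hM Mu; rewrite -[_ *: _]addr0; apply: hM.2 => //; case: hM. Qed.

Lemma submodD M u v : submod M -> M u -> M v -> M (u + v).
Proof. by move=> hM Mu Mv; rewrite -[u]scale1r; apply: hM.2. Qed.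

Lemma submodN M u : submod M -> M u -> M (- u).
Proof. by move=> hM Mu; rewrite -scaleN1r; apply: submodZ. Qed.

Lemma submodB M u v : submod M -> M u -> M v -> M (u - v).
Proof. by move=> hM Mu Mv; apply: submodD => //; apply: submodN. Qed.

Lemma submod_sum M (I : Type) (r : seq I) (P : pred I) (F : I -> W) :
  submod M -> (forall i, P i -> M (F i)) -> M (\sum_(i <- r | P i) F i).
Proof.
move=> hM MF; elim/big_ind: _ => //; first by case: hM.
by move=> u v; apply: submodD.
Qed.

Lemma linear_on0 (X : lmodType R) M (h : W -> X) :
  submod M -> linear_on M h -> h 0 = 0.
Proof.
move=> hM hh; have := hh (-1) 0 0 hM.1 hM.1.
by rewrite scaler0 addr0 scaleN1r addNr.
Qed.

Definition submod_ker (X : lmodType R) (f : {linear W -> X}) :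
  submod (fun u => f u = 0).
Proof. by split=> [|a u v fu fv]; rewrite ?linear0 // linearP fu fv scaler0 addr0. Qed.

Definition submod_image (X : lmodType R) (f : {linear X -> W}) :
  submod (fun w => exists u, f u = w).
Proof.
split; first by exists 0; rewrite linear0.
by move=> a _ _ [u <-] [v <-]; exists (a *: u + v); rewrite linearP.
Qed.

End Submodules.

(** * Projective dimension of submodules; Schanuel's lemma *)

Section ProjectiveDimension.
Variable R : comNzRingType.

Definition mklin (U V : lmodType R) (f : U -> V) (hf : linear f) :
  {linear U -> V} := HB.pack f (GRing.isLinear.Build R U V _ f hf).

Lemma mklinE (U V : lmodType R) (f : U -> V) (hf : linear f) u :
  mklin hf u = f u.
Proof. by []. Qed.

Definition comb (W : lmodType R) r (g : 'I_r -> W) (u : 'rV[R]_r) : W :=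
  \sum_i u 0 i *: g i.

Fact comb_linear (W : lmodType R) r (g : 'I_r -> W) : linear (comb g).
Proof.
move=> a u v; rewrite /comb scaler_sumr -big_split; apply: eq_bigr => i _ /=.
by rewrite !mxE scalerDl scalerA.
Qed.

HB.instance Definition _ (W : lmodType R) r (g : 'I_r -> W) :=
  GRing.isLinear.Build R 'rV[R]_r W _ (comb g) (comb_linear g).

Lemma comb_delta (W : lmodType R) r (g : 'I_r -> W) i :
  comb g (delta_mx 0 i) = g i.
Proof.
rewrite /comb (bigD1 i) //= big1 => [|j ji]; rewrite !mxE eqxx ?eqxx.
  by rewrite scale1r addr0.
by rewrite (negPf ji) scale0r.
Qed.

Lemma linear_combE (W : lmodType R) r (f : {linear 'rV[R]_r -> W}) u :
  f u = comb (fun i => f (delta_mx 0 i)) u.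
Proof.
by rewrite [u in LHS]row_sum_delta linear_sum /comb; apply: eq_bigr => i _; rewrite linearZ.
Qed.

Lemma projective_rV r : projective ('rV[R]_r).
Proof.
move=> M N f g fS.
have [s fs] := choice (fun i y => f y = g (delta_mx 0 i)) (fun i => fS _).
exists (comb s) => u; rewrite [RHS]linear_combE /comb linear_sum.
by apply: eq_bigr => i _; rewrite linearZ /= fs.
Qed.

Lemma projective_prod (P Q : lmodType R) :
  projective P -> projective Q -> projective (P * Q)%type.
Proof.
move=> hP hQ M N f g fS.
have l1 : linear (fun p : P => g (p, 0)).
  by move=> a u v; rewrite -linearP; congr (g _); congr pair; rewrite /= ?scaler0 ?addr0.
have l2 : linear (fun q : Q => g (0, q)).
  by move=> a u v; rewrite -linearP; congr (g _); congr pair; rewrite /= ?scaler0 ?addr0.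
have [h1 e1] := hP M N f (mklin l1) fS.
have [h2 e2] := hQ M N f (mklin l2) fS.
have lh : linear (fun u : P * Q => h1 u.1 + h2 u.2).
  by move=> a u v; rewrite !linearP scalerDr addrACA.
exists (mklin lh) => -[p q]; rewrite mklinE linearD e1 e2 !mklinE -linearD.
by congr (g _); congr pair; rewrite /= ?addr0 ?add0r.
Qed.

(** Here [f] need not be onto. Projectivity is applied to the projection of the fibre product {(q,
    p) | f q = g p} onto P, which is onto; the first component of a splitting is the lift. *)
Lemma projective_lift (P Q W : lmodType R) (f : {linear Q -> W})
    (g : {linear P -> W}) :
  projective P -> (forall u, exists v, f v = g u) ->
  exists h : {linear P -> Q}, forall u, f (h u) = g u.
Proof.
move=> hP fg.
pose T := fun qp : Q * P => f qp.1 = g qp.2.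
have hT : submod T.
  split=> [|a u v]; rewrite /T /=; first by rewrite !linear0.
  by move=> Tu Tv; rewrite !linearP Tu Tv.
have l : linear (fun t : sub_lmod hT => (val t).2).
  by move=> a u v; rewrite !linearP.
have li : linear (@id P) by [].
have [|h hh] := hP _ _ (mklin l) (mklin li).
  by move=> p; have [q qp] := fg p; exists (in_sub hT (qp : T (q, p))).
have lh : linear (fun p => (val (h p)).1) by move=> a u v; rewrite !linearP.
exists (mklin lh) => u; rewrite mklinE.
by have := sub_valM (h u); rewrite /T => ->; have := hh u; rewrite !mklinE => ->.
Qed.

Lemma pd_le_eq (W : lmodType R) (M M' : W -> Prop) k :
  (forall w, M w <-> M' w) -> pd_le M k -> pd_le M' k.
Proof.
move=> MM' [P [d [eps [h1 h2 h3 h4 h5]]]]; exists P, d, eps; split=> // w.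
by rewrite -MM'.
Qed.

Lemma pd_le_submod (W : lmodType R) (M : W -> Prop) k : pd_le M k -> submod M.
Proof.
move=> [P [d [eps [_ h2 _ _ _]]]]; have hI := submod_image eps.
split; first by apply/h2; case: hI.
by move=> a u v /h2 hu /h2 hv; apply/h2; apply: hI.2.
Qed.

(** Peeling off the augmentation lets later arguments run by induction on the length, without
    complexes. *)
Lemma pd_leS (W : lmodType R) (M : W -> Prop) k :
  pd_le M k.+1 <-> exists (P : lmodType R) (eps : {linear P -> W}),
    [/\ projective P, forall w, M w <-> exists u, eps u = w
      & pd_le (fun u => eps u = 0) k].
Proof.
split=> [[P [d [eps [h1 h2 h3 h4 h5]]]]|[P [eps [hP hM [Q [d [e [h1 h2 h3 h4 h5]]]]]]]].
  exists (P 0%N), eps; split=> //.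
  exists (fun i => P i.+1), (fun i => d i.+1), (d 0%N); split=> //.
  by move=> i u ki; apply: (h5 i.+1).
pose Q' : nat -> lmodType R := fun i => if i is j.+1 then Q j else P.
exists Q', (fun i => if i is j.+1 return {linear Q' i.+1 -> Q' i} then d j else e).
by exists eps; split=> //; case=> //.
Qed.

Lemma pd_le0 (W : lmodType R) (M : W -> Prop) :
  pd_le M 0 <-> exists (P : lmodType R) (eps : {linear P -> W}),
    [/\ projective P, forall w, M w <-> exists u, eps u = w
      & forall u, eps u = 0 -> u = 0].
Proof.
split=> [[P [d [eps [h1 h2 h3 h4 h5]]]]|[P [eps [hP hM inj]]]].
  exists (P 0%N), eps; split=> // u /h3[v <-].
  by rewrite (h5 1%N v) // linear0.
have lz (U V : lmodType R) : linear (fun _ : U => 0 : V).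
  by move=> a u v; rewrite scaler0 addr0.
pose Q : nat -> lmodType R := fun i => if i is j.+1 then 'rV[R]_0 else P.
exists Q, (fun i => mklin (lz (Q i.+1) (Q i))), eps.
have z0 (u : 'rV[R]_0) : u = 0 by apply/rowP => -[].
split=> //.
- by case=> [|i] //; apply: projective_rV.
- move=> u; split=> [/inj ->|[v <-]]; first by exists 0.
  by rewrite mklinE linear0.
- move=> i u; split=> [_|[v <-]]; last by rewrite !mklinE.
  by exists 0; rewrite mklinE; symmetry; apply: z0.
- by case.
Qed.

(** Projectivity of [M] itself, with maps linear only on [M]. *)
Definition proj_on (W : lmodType R) (M : W -> Prop) : Prop :=
  forall (A B : lmodType R) (f : {linear A -> B}) (g : W -> B),
    (forall y, exists x, f x = y) -> linear_on M g ->
    exists2 h : W -> A, linear_on M h & forall w, M w -> f (h w) = g w.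

Lemma pd_le0_proj_on (W : lmodType R) (M : W -> Prop) :
  pd_le M 0 <-> submod M /\ proj_on M.
Proof.
split=> [pM|[hM pM]].
  split; first exact: pd_le_submod pM.
  have [P [eps [hP hI inj]]] := (pd_le0 M).1 pM.
  move=> A B f g fS lg.
  have l : linear (fun u => g (eps u)).
    by move=> a u v; rewrite linearP lg //; apply/hI; [exists u|exists v].
  have [h hh] := hP _ _ f (mklin l) fS.
  have [s hs] : exists s : W -> P, forall w, M w -> eps (s w) = w.
    apply: (choice (fun w u => M w -> eps u = w)) => w.
    by have [/hI[u <-]|Mw] := classic (M w); [exists u|exists 0].
  exists (fun w => h (s w)) => [a u v Mu Mv|w Mw]; last by rewrite hh mklinE hs.
  rewrite -linearP; congr (h _); apply/subr0_eq/inj.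
  have hM : submod M by apply: pd_le_submod pM.
  by rewrite linearB linearP !hs ?subrr //; apply: hM.2.
apply/pd_le0; exists (sub_lmod hM).
have l : linear (fun u : sub_lmod hM => val u) by move=> a u v; rewrite linearP.
exists (mklin l); split.
- move=> A B f g fS.
  (* The given map on the subtype is extended by 0 outside [M]. *)
  pose gg w := if excluded_middle_informative (M w) is left Mw
    then g (in_sub hM Mw) else 0.
  have ggE (u : sub_lmod hM) : gg (val u) = g u.
    rewrite /gg; case: excluded_middle_informative => [m|[]].
      by congr (g _); apply: val_inj.
    exact: sub_valM.
  have [|h lh hh] := pM A B f gg fS.
    move=> a u v Mu Mv.
    by rewrite -[u]/(val (in_sub hM Mu)) -[v]/(val (in_sub hM Mv)) -linearP !ggE linearP.
  have l' : linear (fun u : sub_lmod hM => h (val u)).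
    by move=> a u v; rewrite linearP lh //; apply: sub_valM.
  by exists (mklin l') => u; rewrite mklinE hh ?ggE //; apply: sub_valM.
- move=> w; split=> [Mw|[u <-]]; last exact: sub_valM.
  by exists (in_sub hM Mw).
- by move=> u; rewrite mklinE => u0; apply: val_inj; rewrite u0.
Qed.

Lemma pd_le0_section (W P : lmodType R) (M : W -> Prop) (f : {linear P -> W}) :
  pd_le M 0 -> (forall w, M w <-> exists u, f u = w) ->
  exists2 s : W -> P, linear_on M s & forall w, M w -> f (s w) = w.
Proof.
move=> /pd_le0_proj_on[hM pM] fM.
have lp : linear (fun u => in_sub hM ((fM (f u)).2 (ex_intro _ u erefl))).
  by move=> a u v; apply: val_inj; rewrite /= linearP.
pose g w := if excluded_middle_informative (M w) is left Mw
  then in_sub hM Mw else 0.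
have gE w : M w -> val (g w) = w.
  by rewrite /g; case: excluded_middle_informative.
have [||s ls hs] := pM _ _ (mklin lp) g.
- move=> y; have [u hu] := (fM (val y)).1 (sub_valM y).
  by exists u; apply: val_inj; rewrite /= hu.
- move=> a u v Mu Mv; apply: val_inj; rewrite gE ?linearP /= ?gE //.
  exact: hM.2.
by exists s => // w Mw; have := congr1 val (hs w Mw); rewrite gE.
Qed.

(** Among other uses, this passes between forms and their numerators, where [f] is division by a
    fixed denominator. Augmentations are composed with [f], or with its inverse on the image. *)
Lemma pd_le_inj (W W' : lmodType R) (f : {linear W -> W'}) (M : W -> Prop) k :
  submod M -> (forall u, M u -> f u = 0 -> u = 0) ->
  pd_le M k <-> pd_le (fun w => exists2 u, M u & f u = w) k.
Proof.
move=> hM inj; split=> [] [P [d [eps [h1 h2 h3 h4 h5]]]].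
  have l : linear (fun u => f (eps u)) by move=> a u v; rewrite !linearP.
  exists P, d, (mklin l); split=> //.
    move=> w; split=> [[u /h2[v <-] <-]|[u <-]]; first by exists v.
    by exists (eps u) => //; apply/h2; exists u.
  move=> u; rewrite -h3; split=> [fu|]; last by rewrite mklinE => ->; rewrite linear0.
  by apply: inj fu; apply/h2; exists u.
have [s hs] : exists s : P 0%N -> W, forall u, M (s u) /\ f (s u) = eps u.
  apply: (choice (fun u w => M w /\ f w = eps u)) => u.
  by have [|w Mw fw] := (h2 (eps u)).2; [exists u|exists w].
have injM u v : M u -> M v -> f u = f v -> u = v.
  move=> Mu Mv fuv; apply/subr0_eq/inj; first exact: submodB.
  by rewrite linearB fuv subrr.
have l : linear s.
  move=> a u v; apply: injM; rewrite ?linearP ?(hs _).2 ?linearP //.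
    exact: (hs _).1.
  by apply: hM.2; apply: (hs _).1.
exists P, d, (mklin l); split=> //.
  move=> w; split=> [Mw|[u <-]]; last exact: (hs _).1.
  have [|u hu] := (h2 (f w)).1; first by exists w.
  by exists u; apply: injM; rewrite ?mklinE ?(hs _).2 //; apply: (hs _).1.
move=> u; rewrite -h3 mklinE; split=> [su|eu]; first by rewrite -(hs u).2 su linear0.
by apply: inj; [apply: (hs _).1|rewrite (hs _).2].
Qed.

(** The hypothesis makes f(A) + g(P) a direct sum of copies of A and P. A projective summand is
    absorbed in degree 0 of a resolution, without changing the first syzygy. *)
Lemma pd_le_directD (U P X : lmodType R) (f : {linear U -> X})
    (g : {linear P -> X}) (A : U -> Prop) k :
  projective P -> (forall u p, A u -> f u + g p = 0 -> u = 0 /\ p = 0) ->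
  pd_le A k -> pd_le (fun x => exists u p, A u /\ x = f u + g p) k.
Proof.
move=> hP inj; have l (Q : lmodType R) (e : {linear Q -> U}) :
    linear (fun qp : Q * P => f (e qp.1) + g qp.2).
  by move=> a u v; rewrite !linearP scalerDr addrACA.
case: k => [/pd_le0[Q [e [hQ hA einj]]]|k /pd_leS[Q [e [hQ hA pk]]]].
  apply/pd_le0; exists (Q * P)%type, (mklin (l _ e)); split.
  - exact: projective_prod.
  - move=> x; split=> [[u [p [/hA[q <-] ->]]]|[[q p] <-]]; first by exists (q, p).
    by exists (e q), p; split=> //; apply/hA; exists q.
  - move=> [q p]; rewrite mklinE /= => /inj[|/einj -> -> //].
    by apply/hA; exists q.
apply/pd_leS; exists (Q * P)%type, (mklin (l _ e)); split.
- exact: projective_prod.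
- move=> x; split=> [[u [p [/hA[q <-] ->]]]|[[q p] <-]]; first by exists (q, p).
  by exists (e q), p; split=> //; apply/hA; exists q.
have li : linear (fun q : Q => (q, 0 : P)).
  by move=> a u v; congr pair; rewrite /= ?scaler0 ?addr0.
have := (pd_le_inj (f := mklin li) k (submod_ker e)
  (fun u _ h => congr1 fst h)).1 pk.
apply: pd_le_eq => -[q p].
rewrite !mklinE /=; split=> [[u eu [<- <-]]|]; first by rewrite eu !linear0 addr0.
move=> /inj[|eq ->]; first by apply/hA; exists q.
by exists q.
Qed.

(* Schanuel's lemma. *)
Lemma pd_le_syzygy (W Q : lmodType R) (M : W -> Prop) (f : {linear Q -> W}) k :
  projective Q -> (forall w, M w <-> exists u, f u = w) ->
  pd_le M k.+1 -> pd_le (fun u => f u = 0) k.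
Proof.
move=> hQ fM /pd_leS[P [e [hP eM pk]]].
have [a fa] : exists a : {linear P -> Q}, forall u, f (a u) = e u.
  by apply: projective_lift => // u; apply/fM/eM; exists u.
have [b eb] : exists b : {linear Q -> P}, forall u, e (b u) = f u.
  by apply: projective_lift => // u; apply/eM/fM; exists u.
case: k pk => [/pd_le0[P1 [e1 [hP1 hk inj]]]|k /pd_leS[P1 [e1 [hP1 hk pk]]]].
  apply/pd_le0_proj_on; split; first exact: submod_ker.
  move=> A B F G FS lG.
  (* With [P1] in the role of ker e, the map (p, q) -> a p + (q - a (b q)) from ker e + Q to ker f
     has the section q -> (b q, q): ker f is a retract of a projective module. *)
  have l : linear (fun u : P1 * Q => G (a (e1 u.1) + (u.2 - a (b u.2)))).
    move=> c u v; rewrite -lG.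
    - by congr (G _); rewrite !linearP /= !scalerDr (addrACA (c *: u.2)) [LHS]addrACA.
    - rewrite linearD fa linearB fa eb subrr addr0.
      by apply/hk; exists u.1.
    - rewrite linearD fa linearB fa eb subrr addr0.
      by apply/hk; exists v.1.
  have [h hh] := projective_prod hP1 hQ (mklin l) FS.
  have [s hs] : exists s : Q -> P1, forall q, f q = 0 -> e1 (s q) = b q.
    apply: (choice (fun q p => f q = 0 -> e1 p = b q)) => q.
    have [fq|] := classic (f q = 0); last by exists 0.
    by have [|p hp] := (hk (b q)).1; [rewrite eb|exists p].
  exists (fun q => h (s q, q)) => [c u v fu fv|w fw].
    rewrite -linearP; congr (h _); congr pair; apply/subr0_eq/inj.
    rewrite linearB /= linearP !hs /= ?[f _]linearP ?fu ?fv ?scaler0 ?addr0 //.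
    by rewrite [b _]linearP subrr.
  by rewrite hh mklinE /= hs // addrCA subrr addr0.
apply/pd_leS.
have l : linear (fun u : P1 * Q => a (e1 u.1) + (u.2 - a (b u.2))).
  by move=> c u v; rewrite !linearP /= !scalerDr (addrACA (c *: u.2)) [LHS]addrACA.
exists (P1 * Q)%type, (mklin l); split.
- exact: projective_prod.
- move=> q; split=> [fq|[[p q'] <-]].
    have [|p hp] := (hk (b q)).1; first by rewrite eb.
    by exists (p, q); rewrite mklinE /= hp addrCA subrr addr0.
  rewrite mklinE linearD fa linearB fa eb subrr addr0.
  by apply/hk; exists p.
have lba : linear (fun p => b (a p) - p).
  by move=> c u v; rewrite !linearP /= scalerDr addrACA.
(* The kernel of the cover P1 + Q -> ker f is a direct sum of ker e1 and a copy of P: the element v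
   of P goes to (c v, a v), where c lifts b a - 1 through e1. *)
have [c hc] : exists c : {linear P -> P1}, forall p, e1 (c p) = b (a p) - p.
  have [|c hc] := projective_lift (f := e1) (g := mklin lba) hP.
    by move=> u; apply/hk; rewrite mklinE linearB eb fa subrr.
  by exists c.
have li : linear (fun q : P1 => (q, 0 : Q)).
  by move=> t u v; congr pair; rewrite /= ?scaler0 ?addr0.
have lc : linear (fun p : P => (c p, a p)) by move=> t u v; rewrite !linearP.
apply: pd_le_eq (pd_le_directD (f := mklin li) (g := mklin lc) hP _ pk).
  move=> [p q]; rewrite !mklinE /=; split=> [[u [v [e1u [-> ->]]]]|E].
    by rewrite linearD e1u hc !add0r [a (_ - _)]linearB addrA subrK subrr.
  have aE : a (b q - e1 p) = q.
    rewrite linearB /=; apply/eqP; rewrite subr_eq -subr_eq0 -oppr_eq0 opprB -addrA.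
    by rewrite addrCA E.
  exists (p - c (b q - e1 p)), (b q - e1 p); split.
    by rewrite linearB hc aE subKr subrr.
  by congr pair; rewrite /= ?aE ?add0r ?subrK.
move=> u p e1u; rewrite !mklinE => -[/= E1 E2].
have ap : a p = 0 by rewrite -[RHS]E2 add0r.
have cp : u = - c p by apply/eqP; rewrite -addr_eq0 E1.
have : e1 (c p) = - p by rewrite hc ap linear0 add0r.
have -> : c p = - u by rewrite cp opprK.
rewrite linearN e1u oppr0 => /esym/eqP; rewrite oppr_eq0 => /eqP p0.
by split=> //; rewrite cp p0 linear0 oppr0.
Qed.

End ProjectiveDimension.

(** * Finite generation *)

Section FiniteGeneration.
Variable R : comNzRingType.

Definition fin_gen (W : lmodType R) (M : W -> Prop) : Prop :=
  exists s (g : 'I_s -> W), generates M g.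

(** Stated for submodules of R^r, because it is applied to kernels of covers by R^r; the reduction
    to ideals is [noetherian_ideals]. *)
Definition noetherian : Prop :=
  forall r (M : 'rV[R]_r -> Prop), submod M -> fin_gen M.

Lemma generatesP (W : lmodType R) (M : W -> Prop) s (g : 'I_s -> W) :
  generates M g <-> forall w, M w <-> exists u, comb g u = w.
Proof.
have E w : (exists c : 'I_s -> R, w = \sum_i c i *: g i) <->
    (exists u, comb g u = w).
  split=> [[c ->]|[u <-]]; last by exists (u 0).
  by exists (\row_i c i); apply: eq_bigr => i _; rewrite mxE.
by split=> h w; rewrite h E.
Qed.

Lemma generates_gen (W : lmodType R) (M : W -> Prop) s (g : 'I_s -> W) i :
  generates M g -> M (g i).
Proof.
by move=> /generatesP ->; exists (delta_mx 0 i); rewrite comb_delta.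
Qed.

End FiniteGeneration.

(** Serves to read a lifting problem over [Rb] as one over [R], to which projectivity over [R]
    applies. The morphism occurs in the type so that it determines the scalar action. *)
Definition restr_scal (R Rb : comNzRingType) (red : {rmorphism R -> Rb})
  (A : lmodType Rb) : Type := A.

Section RestrictionOfScalars.
Variables (R Rb : comNzRingType) (red : {rmorphism R -> Rb}) (A : lmodType Rb).

HB.instance Definition _ := GRing.Zmodule.on (restr_scal red A).

Definition rscale (a : R) (u : restr_scal red A) : restr_scal red A :=
  (red a *: (u : A)).

Fact rscaleA a b u : rscale a (rscale b u) = rscale (a * b) u.
Proof. by rewrite /rscale rmorphM scalerA. Qed.
Fact rscale1 : left_id 1 rscale.
Proof. by move=> u; rewrite /rscale rmorph1 scale1r. Qed.
Fact rscaleDr : right_distributive rscale +%R.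
Proof. by move=> a u v; rewrite /rscale scalerDr. Qed.
Fact rscaleDl u : {morph rscale^~ u : a b / a + b}.
Proof. by move=> a b; rewrite /rscale rmorphD scalerDl. Qed.

HB.instance Definition _ := GRing.Zmodule_isLmodule.Build R (restr_scal red A)
  rscaleA rscale1 rscaleDr rscaleDl.

Lemma restr_scaleE (a : R) (u : restr_scal red A) :
  a *: u = (red a *: (u : A)) :> A.
Proof. by []. Qed.

End RestrictionOfScalars.

Definition semilinear_on (R Rb : comNzRingType) (red : {rmorphism R -> Rb})
    (W : lmodType R) (Wb : lmodType Rb) (M : W -> Prop) (rho : W -> Wb) : Prop :=
  forall a u v, M u -> M v -> rho (a *: u + v) = red a *: rho u + rho v.

Lemma semilinear_on_image (R Rb : comNzRingType) (red : {rmorphism R -> Rb})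
    (U W : lmodType R) (Ub Wb : lmodType Rb) (f : {linear U -> W})
    (g : {linear Ub -> Wb}) (M : U -> Prop) (M' : W -> Prop) (r : U -> Ub)
    (r' : W -> Wb) :
  submod M -> semilinear_on red M r ->
  (forall w, M' w <-> exists2 u, M u & f u = w) ->
  (forall u, M u -> r' (f u) = g (r u)) -> semilinear_on red M' r'.
Proof.
move=> hM lr M'E rE a _ _ /M'E[u Mu <-] /M'E[v Mv <-].
by rewrite -linearP !rE ?lr ?linearP //; apply: hM.2.
Qed.

(** * Projective dimension over R and over R / x R *)

Section ChangeOfRings.
Variables (R Rb : comNzRingType) (red : {rmorphism R -> Rb}).
Variables (lft : {rmorphism Rb -> R}) (x : R).
Hypothesis lftK : cancel lft red.
Hypothesis red_eq0 : forall a, red a = 0 <-> exists c, a = x * c.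
Hypothesis x_regular : forall a, x * a = 0 -> a = 0.

(* 0 -> R^q -> M -> N -> 0 is exact, where N is a module over R / x R. *)
Record free_extension (W : lmodType R) (Wb : lmodType Rb) (M : W -> Prop)
    (N : Wb -> Prop) (rho : W -> Wb) (q : nat) (j : {linear 'rV[R]_q -> W}) :
    Prop := FreeExtension {
  fe_submod : submod M;
  fe_rho : semilinear_on red M rho;
  fe_image : forall n, N n <-> exists2 m, M m & rho m = n;
  fe_ker : forall m, M m /\ rho m = 0 <-> exists u, j u = m;
  fe_inj : forall u, j u = 0 -> u = 0 }.

Let redv r (u : 'rV[R]_r) : 'rV[Rb]_r := map_mx red u.
Let lftv r (u : 'rV[Rb]_r) : 'rV[R]_r := map_mx lft u.

Let redvP r a (u v : 'rV[R]_r) : redv (a *: u + v) = red a *: redv u + redv v.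
Proof. by rewrite /redv map_mxD map_mxZ. Qed.

Let lftvP r a (u v : 'rV[Rb]_r) : lftv (a *: u + v) = lft a *: lftv u + lftv v.
Proof. by rewrite /lftv map_mxD map_mxZ. Qed.

Let lftvK r : cancel (@lftv r) (@redv r).
Proof. by move=> u; apply/rowP => i; rewrite !mxE lftK. Qed.

Let redx : red x = 0.
Proof. by apply/red_eq0; exists 1; rewrite mulr1. Qed.

Let redv_eq0 m r (u : 'M[R]_(m, r)) :
  map_mx red u = 0 <-> exists v : 'M[R]_(m, r), u = x *: v.
Proof.
split=> [u0|[v ->]]; last by rewrite map_mxZ redx scale0r.
have [f hf] : exists f : 'I_m * 'I_r -> R, forall ij, u ij.1 ij.2 = x * f ij.
  apply: (choice (fun ij c => u ij.1 ij.2 = x * c)) => ij; apply/red_eq0.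
  by have := congr1 (fun A : 'M_(_, _) => A ij.1 ij.2) u0; rewrite !mxE.
by exists (\matrix_(i, k) f (i, k)); apply/matrixP => i k; rewrite !mxE -(hf (i, k)).
Qed.

Let scalex_inj m r (u : 'M[R]_(m, r)) : x *: u = 0 -> u = 0.
Proof.
move=> xu; apply/matrixP => i k; rewrite [RHS]mxE; apply: x_regular.
by have := congr1 (fun A : 'M_(_, _) => A i k) xu; rewrite !mxE.
Qed.

Section Cover.
Variables (W : lmodType R) (Wb : lmodType Rb) (M : W -> Prop) (N : Wb -> Prop).
Variables (rho : W -> Wb) (q : nat) (j : {linear 'rV[R]_q -> W}).
Hypothesis E : free_extension M N rho j.
Variables (r : nat) (pi : {linear 'rV[Rb]_r -> Wb}).
Hypothesis pi_image : forall n, N n <-> exists u, pi u = n.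

Let K (u : 'rV[R]_r) : Prop := pi (redv u) = 0.

(** The kernel embeds in R^r because [j] is injective. A vector u of R^r belongs to its image
    exactly when the combination of the lifted generators lies in the image of [j], that is, has
    residue 0; this residue is pi (u mod x). *)
Lemma extension_cover :
  exists f : {linear ('rV[R]_q * 'rV[R]_r)%type -> W},
    (forall w, M w <-> exists u, f u = w) /\
    forall k, pd_le (fun u => f u = 0) k <-> pd_le K k.
Proof.
have hM := fe_submod E.
have rho0 : rho 0 = 0.
  have := fe_rho E (-1) hM.1 hM.1.
  by rewrite scaler0 addr0 rmorphN1 scaleN1r addNr.
have rhoD u v : M u -> M v -> rho (u + v) = rho u + rho v.
  by move=> Mu Mv; rewrite -[u]scale1r (fe_rho E) // rmorph1 !scale1r.
have rhoZ a u : M u -> rho (a *: u) = red a *: rho u.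
  by move=> Mu; rewrite -[a *: u]addr0 (fe_rho E) // ?rho0 ?addr0 //; case: hM.
have [g hg] : exists g : 'I_r -> W,
    forall i, M (g i) /\ rho (g i) = pi (delta_mx 0 i).
  apply: (choice (fun i m => M m /\ rho m = pi (delta_mx 0 i))) => i.
  have [|m Mm rm] := (fe_image E (pi (delta_mx 0 i))).1; last by exists m.
  by apply/pi_image; exists (delta_mx 0 i).
have Mg u : M (comb g u).
  by apply: submod_sum => // i _; apply: submodZ => //; exact: (hg i).1.
have rg u : rho (comb g u) = pi (redv u).
  rewrite linear_combE /comb.
  suff [] : M (\sum_i u 0 i *: g i) /\
      rho (\sum_i u 0 i *: g i) = \sum_i redv u 0 i *: pi (delta_mx 0 i) by [].
  elim/big_ind2: _ => [|a1 b1 a2 b2 [M1 <-] [M2 <-]|i _].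
  - by split=> //; case: hM.
  - by split; [apply: submodD|apply: rhoD].
  - split; first by apply: submodZ => //; exact: (hg i).1.
    by rewrite rhoZ ?(hg i).2 ?mxE //; exact: (hg i).1.
have Mj u : M (j u) by apply: (fun h => (proj1 h)); apply/(fe_ker E); exists u.
have rj u : rho (j u) = 0.
  by apply: (fun h => (@proj2 (M (j u)) _ h)); apply/(fe_ker E); exists u.
have l : linear (fun u : 'rV[R]_q * 'rV[R]_r => j u.1 + comb g u.2).
  by move=> a u v; rewrite !linearP scalerDr addrACA.
exists (mklin l); split=> [w|k].
  split=> [Mw|[[a u] <-]]; last by apply: submodD => //; apply: Mj.
  have [|v hv] := (pi_image (rho w)).1; first by apply/(fe_image E); exists w.
  have [|a ha] := (fe_ker E (w - comb g (lftv v))).1.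
    split; first exact: submodB.
    rewrite -scaleN1r rhoD ?rhoZ ?rg ?lftvK ?hv //; last exact: submodZ.
    by rewrite rmorphN1 scaleN1r subrr.
  by exists (a, lftv v); rewrite mklinE /= ha subrK.
have l2 : linear (fun u : 'rV[R]_q * 'rV[R]_r => u.2) by [].
have hK := submod_ker (mklin l).
rewrite (pd_le_inj (f := mklin l2) k hK); last first.
  move=> [a u]; rewrite !mklinE /= => ja u0; congr pair => //.
  by apply: (fe_inj E); rewrite -ja u0 linear0 addr0.
have KE u : (exists2 v, mklin l v = 0 & mklin l2 v = u) <-> K u.
  split=> [[[a v]]|Ku].
    rewrite !mklinE /= => /eqP; rewrite addrC addr_eq0 => /eqP va <-.
    by rewrite /K -rg va -scaleN1r rhoZ ?rj ?scaler0 //; apply: Mj.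
  have [|a ha] := (fe_ker E (- comb g u)).1.
    by split; [apply: submodN|rewrite -scaleN1r rhoZ // rg Ku scaler0].
  by exists (a, u); rewrite ?mklinE //= ha addNr.
by split; apply: pd_le_eq => u; [apply: KE|rewrite KE].
Qed.

Let xfun (u : 'rV[R]_r) := x *: u.
Let xfun_linear : linear xfun.
Proof. by move=> a u v; rewrite /xfun scalerDr !scalerA mulrC. Qed.

Lemma syzygy_extension :
  free_extension K (fun u => pi u = 0) (@redv r) (mklin xfun_linear).
Proof.
split.
- split=> [|a u v Ku Kv]; first by rewrite /K /redv map_mx0 linear0.
  by rewrite /K redvP linearP Ku Kv scaler0 addr0.
- by move=> a u v _ _; rewrite redvP.
- move=> n; split=> [pn|[m Km <-] //].
  by exists (lftv n); rewrite /K ?lftvK.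
- move=> m; split=> [[_ /redv_eq0[v ->]]|[u <-]]; first by exists v.
  have xu : redv (x *: u) = 0 by apply/redv_eq0; exists u.
  by rewrite /K xu linear0.
- by move=> u; apply: scalex_inj.
Qed.

(* If N is a direct summand of Rb^r with complement the image of an idempotent
   matrix e, then K is the image of the injective map e + x (1 - e). *)
Lemma syzygy_lift_projective : pd_le N 0 -> pd_le K 0.
Proof.
move=> pN; have [s ls hs] := pd_le0_section pN pi_image.
have Npi u : N (pi u) by apply/pi_image; exists u.
(* The idempotent [e] is the projection onto ker pi along the image of the section; [el] lifts it to
   an idempotent over [R]. *)
have le : linear (fun u => u - s (pi u)).
  by move=> a u v; rewrite linearP ls // scalerBr opprD addrACA.
pose e := lin1_mx (mklin le).
have eE u : u *m e = u - s (pi u) by rewrite mul_rV_lin1.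
have pe u : pi (u *m e) = 0 by rewrite eE linearB hs ?subrr.
have ze u : pi u = 0 -> u *m e = u.
  move=> pu; rewrite eE pu (linear_on0 _ ls) ?subr0 //.
  exact: pd_le_submod pN.
have ee : e *m e = e.
  by apply/row_matrixP => i; rewrite row_mul; apply: ze; rewrite rowE; apply: pe.
pose el := map_mx lft e; pose el' := 1%:M - el.
have ell : el *m el = el by rewrite -map_mxM ee.
have el'l : el' *m el = 0 by rewrite mulmxBl mul1mx ell subrr.
have el'l' : el' *m el' = el' by rewrite mulmxBr mulmx1 el'l subr0.
have ll' : el *m el' = 0 by rewrite mulmxBr mulmx1 ell subrr.
have red_el : map_mx red el = e.
  by apply/matrixP => i k; rewrite !mxE lftK.
have l : linear (fun u : 'rV[R]_r => u *m el + x *: (u *m el')).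
  move=> a u v; rewrite !mulmxDl -!scalemxAl !scalerDr !scalerA.
  by rewrite [x * a]mulrC addrACA.
apply/pd_le0; exists 'rV[R]_r, (mklin l); split; first exact: projective_rV.
- move=> g; split=> [Kg|[u <-]].
    (* For g in K the reduction is fixed by [e], so g (1 - el) vanishes mod x and may be divided by
       x. The preimage of g is then g el + g' (1 - el). *)
    have [g' hg'] : exists g', g *m el' = x *: g'.
      apply/redv_eq0; rewrite map_mxM map_mxB map_mx1 red_el mulmxBr mulmx1.
      by rewrite ze // subrr.
    exists (g *m el + g' *m el'); rewrite mklinE.
    rewrite !mulmxDl -!mulmxA ell el'l ll' el'l' !mulmx0 addr0 add0r.
    by rewrite scalemxAl -hg' -mulmxA el'l' -mulmxDr addrC subrK mulmx1.
  rewrite /K /redv mklinE map_mxD map_mxM red_el map_mxZ redx scale0r addr0.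
  exact: pe.
- move=> u; rewrite mklinE => u0.
  have ue : u *m el = 0.
    have := congr1 (mulmx^~ el) u0.
    by rewrite mulmxDl -mulmxA ell -scalemxAl -mulmxA el'l mulmx0 scaler0 addr0 mul0mx.
  have ue' : u *m el' = 0 by apply: scalex_inj; rewrite -[RHS]u0 ue add0r.
  by rewrite -[u]mulmx1 -[1%:M](subrK el) mulmxDr ue' ue addr0.
Qed.

Let divx (u : 'rV[R]_r) : 'rV[R]_r :=
  epsilon (inhabits 0) (fun v => u - lftv (redv u) = x *: v).

Let divxP u : u - lftv (redv u) = x *: divx u.
Proof.
apply: (@epsilon_spec _ _ (fun v => u - lftv (redv u) = x *: v)); apply/redv_eq0.
by rewrite map_mxB -/(redv (lftv (redv u))) lftvK subrr.
Qed.

(* With u = u_0 + x u_1 + ..., the map K -> N sending u to pi u_1 is R-linear,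
   and it is onto because x Rb^r is contained in K. *)
Lemma syzygy_desc_projective : submod N -> pd_le K 0 -> pd_le N 0.
Proof.
move=> hN /pd_le0_proj_on[hK pK]; apply/pd_le0_proj_on; split=> //.
move=> A B f g fS lg.
have lf : linear (f : restr_scal red A -> restr_scal red B).
  by move=> a u v; rewrite !restr_scaleE linearP.
pose kap u : restr_scal red B := g (pi (redv (divx u))).
have Npi u : N (pi u) by apply/pi_image; exists u.
have lk : linear_on K kap.
  move=> a u v Ku Kv.
  have [a1 ha] : exists a1, a - lft (red a) = x * a1.
    by apply/red_eq0; rewrite rmorphB lftK subrr.
  (* Division by x is linear only up to a multiple of u_0. Since pi kills the reduction of u_0 for u
     in K, this error disappears in [kap]. *)
  have divxD : divx (a *: u + v) =
      a *: divx u + a1 *: lftv (redv u) + divx v.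
    apply/subr0_eq/scalex_inj; rewrite scalerBr -divxP !scalerDr -divxP.
    rewrite !scalerA [x * a]mulrC -ha -scalerA -divxP redvP lftvP.
    rewrite scalerBl scalerBr [X in X + (v - _)]addrA subrK.
    by rewrite [X in _ + X - _]opprD [X in X - _]addrACA subrr.
  have -> : kap (a *: u + v) =
      g (red a *: pi (redv (divx u)) + pi (redv (divx v))).
    rewrite /kap divxD -addrA redvP redvP lftvK !linearP /=.
    by rewrite Ku scaler0 add0r.
  by rewrite lg.
have [lam llam hlam] := pK _ _ (mklin lf) kap fS lk.
have [s hs] : exists s : Wb -> 'rV[Rb]_r, forall w, N w -> pi (s w) = w.
  apply: (choice (fun w u => N w -> pi u = w)) => w.
  by have [/pi_image[u <-]|Mw] := classic (N w); [exists u|exists 0].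
have Kx u : K (x *: u).
  by rewrite /K; have -> : redv (x *: u) = 0 by [apply/redv_eq0; exists u]; rewrite linear0.
(* The lift of w is lam (x u) for any u over w. Two choices of u differ by some z in K, and lam (x
   z) = red x * lam z = 0. *)
exists (fun w => lam (x *: lftv (s w))) => [a u v Nu Nv|w Nw].
  pose z := s (a *: u + v) - (a *: s u + s v).
  have Kz : K (lftv z).
    rewrite /K lftvK linearB linearP !hs ?subrr //; exact: hN.2.
  have -> : x *: lftv (s (a *: u + v)) =
      x *: lftv z + (lft a *: (x *: lftv (s u)) + x *: lftv (s v)).
    rewrite scalerA mulrC -scalerA -!scalerDr -lftvP.
    by rewrite -[z]scale1r -[lftv (1 *: z)]addr0 /lftv map_mxZ rmorph1 scale1r
       addr0 -map_mxD subrK.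
  rewrite llam //; last by apply: hK.2.
  by rewrite llam // restr_scaleE redx scale0r add0r restr_scaleE lftK.
have := hlam _ (Kx (lftv (s w))); rewrite mklinE => ->; rewrite /kap.
have -> : divx (x *: lftv (s w)) = lftv (s w).
  apply/subr0_eq/scalex_inj; rewrite scalerBr -divxP.
  have -> : redv (x *: lftv (s w)) = 0 by apply/redv_eq0; exists (lftv (s w)).
  by rewrite /lftv map_mx0 subr0 subrr.
by rewrite lftvK hs.
Qed.

End Cover.

Hypothesis Rb_noetherian : noetherian Rb.

(** Passing to syzygies on both sides lowers both bounds by one, and [syzygy_extension] restores the
    hypotheses. Since [Rb] is noetherian, the new N is again finitely generated, hence again covered
    by a finite free module. *)
Lemma pd_le_extension (W : lmodType R) (Wb : lmodType Rb) (M : W -> Prop)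
    (N : Wb -> Prop) (rho : W -> Wb) q (j : {linear 'rV[R]_q -> W}) k :
  free_extension M N rho j -> fin_gen N -> pd_le M k.+1 <-> pd_le N k.
Proof.
elim: k => [|k IH] in W Wb M N rho q j *; move=> E [r [g /generatesP gN]];
  have [f [fM fK]] := extension_cover E gN;
  have pP : projective ('rV[R]_q * 'rV[R]_r)%type
    by apply: projective_prod; apply: projective_rV.
- split=> [pM|pN].
    apply: (syzygy_desc_projective gN); last exact: (fK 0%N).1 (pd_le_syzygy pP fM pM).
    by have hI := submod_image (comb g); split=> [|a u v /gN hu /gN hv]; apply/gN;
      [case: hI|apply: hI.2].
  apply/pd_leS; exists ('rV[R]_q * 'rV[R]_r)%type, f; split=> //.
  exact: (fK 0%N).2 (syzygy_lift_projective gN pN).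
have fgZ : fin_gen (fun u => comb g u = 0).
  by apply: Rb_noetherian; apply: submod_ker.
have ZK := IH _ _ _ _ _ _ _ (syzygy_extension (comb g)) fgZ.
split=> [pM|pN].
  apply/pd_leS; exists 'rV[Rb]_r, (comb g); split=> //; first exact: projective_rV.
  exact: ZK.1 ((fK k.+1).1 (pd_le_syzygy pP fM pM)).
apply/pd_leS; exists ('rV[R]_q * 'rV[R]_r)%type, f; split=> //.
apply: (fK k.+1).2; apply: ZK.2.
by apply: (pd_le_syzygy (f := comb g)) pN => //; exact: projective_rV.
Qed.

End ChangeOfRings.

(** * Noetherian rings and Hilbert's basis theorem *)

Section Noetherian.
Variable R : comNzRingType.

(** Spanning is expressed as lying in every submodule containing both families, which spares the
    handling of coefficients. *)
Lemma fin_gen_span2 (W : lmodType R) (M : W -> Prop) s t (g : 'I_s -> W)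
    (h : 'I_t -> W) :
  submod M -> (forall i, M (g i)) -> (forall i, M (h i)) ->
  (forall T : W -> Prop, submod T -> (forall i, T (g i)) ->
     (forall i, T (h i)) -> forall w, M w -> T w) ->
  fin_gen M.
Proof.
move=> hM Mg Mh span.
pose k (i : 'I_(s + t)) := match split i with inl a => g a | inr b => h b end.
exists (s + t)%N, k; apply/generatesP => w; split=> [|[u <-]]; last first.
  apply: submod_sum => // i _; apply: submodZ => //.
  by rewrite /k; case: (split i).
apply: (span (fun w => exists u, comb k u = w)); first exact: submod_image.
  move=> i; exists (delta_mx 0 (lshift t i)); rewrite comb_delta /k.
  by rewrite (unsplitK (inl i)).
move=> i; exists (delta_mx 0 (rshift s i)); rewrite comb_delta /k.
by rewrite (unsplitK (inr i)).
Qed.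

Lemma fin_gen_eq (W : lmodType R) (M M' : W -> Prop) :
  (forall w, M w <-> M' w) -> fin_gen M -> fin_gen M'.
Proof.
by move=> MM' [s [g gM]]; exists s, g => w; rewrite -MM'.
Qed.

Lemma fin_gen_image (W X : lmodType R) (f : {linear W -> X}) (M : W -> Prop) :
  fin_gen M -> fin_gen (fun x => exists2 u, M u & f u = x).
Proof.
move=> [s [g gM]]; exists s, (fun i => f (g i)) => w.
split=> [[u /gM[c ->] <-]|[c ->]].
  by exists c; rewrite linear_sum; apply: eq_bigr => i _; rewrite linearZ.
exists (\sum_i c i *: g i); first by apply/gM; exists c.
by rewrite linear_sum; apply: eq_bigr => i _; rewrite linearZ.
Qed.

Lemma fin_gen_extension (W X : lmodType R) (f : {linear W -> X})
    (M : W -> Prop) :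
  submod M -> fin_gen (fun x => exists2 u, M u & f u = x) ->
  fin_gen (fun u => M u /\ f u = 0) -> fin_gen M.
Proof.
move=> hM [s [g gI]] [t [h hK]].
have [m hm] : exists m : 'I_s -> W, forall i, M (m i) /\ f (m i) = g i.
  apply: (choice (fun i u => M u /\ f u = g i)) => i.
  by have [u Mu fu] := generates_gen i gI; exists u.
have Mm i : M (m i) by case: (hm i).
have Mh i : M (h i) by case: (generates_gen i hK).
apply: (fin_gen_span2 hM Mm Mh) => T hT Tm Th w Mw.
have [|c fw] := (gI (f w)).1; first by exists w.
have Mc : M (\sum_i c i *: m i).
  by apply: submod_sum => // i _; apply: submodZ.
have [|d hd] := (hK (w - \sum_i c i *: m i)).1.
  split; first exact: submodB.
  rewrite linearB fw linear_sum -sumrB big1 // => i _.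
  by rewrite linearZ /= (hm i).2 subrr.
rewrite -[w](subrK (\sum_i c i *: m i)) hd; apply: submodD => //;
  by apply: submod_sum => // i _; apply: submodZ.
Qed.

(** Induction on the rank: the first coordinates form an ideal, and the vectors with first
    coordinate 0 form a submodule of R^r. *)
Lemma noetherian_ideals :
  (forall I : R^o -> Prop, submod I -> fin_gen I) -> noetherian R.
Proof.
move=> hI; elim=> [|r IH] M hM.
  exists 0%N, (fun _ => 0) => w; have -> : w = 0 by apply/rowP => -[].
  by split=> [_|_]; [exists (fun _ => 0); rewrite big_ord0|case: hM].
have l : linear (fun u : 'rV[R]_r.+1 => u 0 0 : R^o).
  by move=> a u v; rewrite !mxE.
apply: (fin_gen_extension (f := mklin l)) => //.
  apply: hI; split; first by exists 0; [case: hM|rewrite linear0].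
  move=> a _ _ [u Mu <-] [v Mv <-].
  by exists (a *: u + v); [apply: hM.2|rewrite linearP].
pose z (v : 'rV[R]_r) : 'rV[R]_r.+1 := row_mx (0 : 'rV_1) v.
have lz : linear z.
  move=> a u v; have := add_row_mx (a *: 0 : 'rV_1) (a *: u) (0 : 'rV_1) v.
  by rewrite -scale_row_mx scaler0 addr0 => /esym.
have := IH (fun v => M (z v)) _.
have hz : submod (fun v => M (z v)).
  split=> [|a u v Mu Mv]; last by rewrite lz; apply: hM.2.
  by rewrite -[z 0]/(mklin lz 0) linear0; case: hM.
move=> /(_ hz) /(fin_gen_image (mklin lz)); apply: fin_gen_eq => w.
split=> [[u Mu <-]|[Mw w0]].
  split=> //; rewrite !mklinE /z.
  by rewrite mxE; case: splitP => // k _; rewrite mxE.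
have E : w = z (rsubmx (w : 'rV_(1 + r))).
  have l0 : lsubmx (w : 'rV_(1 + r)) = 0.
    apply/rowP => i; rewrite !mxE ord1 -[RHS]w0 mklinE; congr (w 0 _).
    exact: val_inj.
  by rewrite /z -l0; symmetry; apply: (@hsubmxK _ 1 1 r).
by exists (rsubmx (w : 'rV_(1 + r))); rewrite ?mklinE -?E.
Qed.

Lemma noetherian_ideal (I : R^o -> Prop) :
  noetherian R -> submod I -> fin_gen I.
Proof.
move=> nR hI; have l : linear (fun u : 'rV[R]_1 => u 0 0 : R^o).
  by move=> a u v; rewrite !mxE.
have hJ : submod (fun u : 'rV[R]_1 => I (u 0 0)).
  split; first by rewrite mxE; case: hI.
  by move=> a u v Iu Iv; rewrite !mxE; apply: hI.2.
have := fin_gen_image (mklin l) (nR _ _ hJ); apply: fin_gen_eq => a.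
split=> [[u Iu <-] //|Ia]; exists a%:M; rewrite ?mklinE ?mxE ?eqxx ?mulr1n //.
Qed.

Lemma noetherian_fin_gen r (W : lmodType R) (f : {linear 'rV[R]_r -> W})
    (M : W -> Prop) :
  noetherian R -> submod M -> (forall w, M w -> exists u, f u = w) ->
  fin_gen M.
Proof.
move=> nR hM fM; have hJ : submod (fun u => M (f u)).
  split=> [|a u v Mu Mv]; first by rewrite linear0; case: hM.
  by rewrite linearP; apply: hM.2.
have := fin_gen_image f (nR _ _ hJ); apply: fin_gen_eq => w.
by split=> [[u Mu <-] //|Mw]; have [u fu] := fM _ Mw; exists u; rewrite ?fu.
Qed.

End Noetherian.

Lemma noetherian_surj (R S : comNzRingType) (f : {rmorphism R -> S}) :
  (forall y, exists u, f u = y) -> noetherian R -> noetherian S.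
Proof.
move=> fS nR; apply: noetherian_ideals => I hI.
have hJ : submod (fun a : R^o => I (f a)).
  split=> [|a u v Iu Iv]; first by rewrite rmorph0; case: hI.
  by rewrite rmorphD rmorphM; apply: hI.2.
have [s [g gJ]] := noetherian_ideal nR hJ; exists s, (fun i => f (g i)) => w.
split=> [Iw|[c ->]].
  have [u fu] := fS w; have [|c uE] := (gJ u).1; first by rewrite fu.
  exists (fun i => f (c i)); rewrite -fu uE rmorph_sum; apply: eq_bigr => i _.
  by rewrite rmorphM.
by apply: submod_sum => // i _; apply: submodZ => //; apply: (generates_gen i gJ).
Qed.

(* The ideal is generated by elements whose D-th coefficients generate its
   ideal of leading coefficients, together with its elements of degree < D. *)
Lemma hilbert_basis (R : comNzRingType) : noetherian R -> noetherian {poly R}.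
Proof.
move=> nR; apply: noetherian_ideals => I hI.
have IM (p q : {poly R}) : I q -> I (p * q).
  by move=> Iq; apply: (@submodZ _ {poly R}^o _ p q).
have ID (p q : {poly R}) : I p -> I q -> I (p + q).
  by apply: (@submodD _ {poly R}^o).
(* The coefficient at d is allowed to vanish, which makes [L] closed under addition. *)
pose L (c : R^o) := exists (f : {poly R}) d, [/\ I f, (size f <= d.+1)%N & f`_d = c].
have hL : submod L.
  split; first by exists 0, 0%N; split; rewrite ?size_poly0 ?coef0 //; case: hI.
  move=> a _ _ [f [d [If sf <-]]] [g [e [Ig sg <-]]].
  exists (a%:P * ('X^e * f) + 'X^d * g), (d + e)%N; split.
  - by apply: ID; apply: (IM) => //; apply: (IM).
  - apply: leq_trans (size_polyD _ _) _; rewrite geq_max; apply/andP; split.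
      rewrite mul_polyC; apply: leq_trans (size_scale_leq _ _) _.
      apply: leq_trans (size_polyMleq _ _) _.
      by rewrite size_polyXn addSn /= addnC -addSn leq_add2r.
    apply: leq_trans (size_polyMleq _ _) _.
    by rewrite size_polyXn addSn /= -addnS leq_add2l.
  - rewrite coefD mul_polyC coefZ !coefXnM addnK addKn.
    by rewrite !ltnNge leq_addl leq_addr.
have [s [c cL]] := noetherian_ideal nR hL.
have [D [f hf]] : exists D (f : 'I_s -> {poly R}),
    forall i, [/\ I (f i), (size (f i) <= D.+1)%N & (f i)`_D = c i].
  have [fd hfd] := choice (fun i (fd : {poly R} * nat) =>
    [/\ I fd.1, (size fd.1 <= fd.2.+1)%N & fd.1`_fd.2 = c i]) (fun i =>
    let: ex_intro f (ex_intro d h) := generates_gen i cL in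
    ex_intro _ (f, d) h).
  pose D := (\max_i (fd i).2)%N; exists D, (fun i => 'X^(D - (fd i).2) * (fd i).1).
  move=> i; have [If sf fc] := hfd i.
  have dD : ((fd i).2 <= D)%N by apply: (leq_bigmax i).
  split; first exact: IM.
    apply: leq_trans (size_polyMleq _ _) _.
    rewrite size_polyXn addSn /=; apply: leq_trans (leq_add (leqnn _) sf) _.
    by rewrite addnS subnK.
  by rewrite coefXnM ltnNge leq_subr /= subKn.
pose MD (v : 'rV[R]_D) := I (rVpoly v).
have hMD : submod MD.
  split=> [|a u v Mu Mv]; rewrite /MD ?linear0 ?linearP; first by case: hI.
  by rewrite /= -mul_polyC; apply: ID => //; apply: IM.
have [t [v vM]] := nR _ _ hMD.
apply: (fin_gen_span2 hI (fun i => let: And3 h _ _ := hf i in h)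
  (fun i => generates_gen i vM)) => T hT Tf Tv.
have TM (p q : {poly R}) : T q -> T (p * q).
  by move=> Tq; apply: (@submodZ _ {poly R}^o _ p q).
have TD (p q : {poly R}) : T p -> T q -> T (p + q).
  by apply: (@submodD _ {poly R}^o).
have Tsum n (F : 'I_n -> {poly R}) : (forall i, T (F i)) -> T (\sum_i F i).
  by move=> TF; apply: (@submod_sum _ {poly R}^o).
move=> p; have [k] := ubnP (size p); elim: k p => // k IH p pk Ip.
have [pD|Dp] := leqP (size p) D.
  have [|a pE] := (vM (poly_rV p)).1; first by rewrite /MD poly_rV_K.
  rewrite -(poly_rV_K pD) pE linear_sum; apply: Tsum => i.
  by rewrite linearZ /= -mul_polyC; apply: TM.
have [|a pE] := (cL (lead_coef p)).1.
  exists p, (size p).-1; split=> //; rewrite ?leqSpred //.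
pose q := \sum_i (a i)%:P * ('X^((size p).-1 - D) * f i).
have sp : size p = (size p).-1.+1 by rewrite prednK // (leq_trans _ Dp).
have Dp' : (D <= (size p).-1)%N by rewrite -ltnS -sp.
have Iq : I q.
  by apply: (@submod_sum _ {poly R}^o) => // i _; do 2! apply: (IM); case: (hf i).
have Tq : T q by apply: Tsum => i; do 2! apply: (TM).
rewrite -[p](subrK q); apply: TD => //; apply: IH; last first.
  by apply: ID => //; rewrite -mulN1r; apply: IM.
rewrite -ltnS; apply: leq_trans pk; rewrite ltnS [X in (_ < X)%N]sp ltnS.
apply/leq_sizeP => j; rewrite leq_eqVlt => /orP[/eqP <-|pj].
  rewrite coefB -lead_coefE pE coef_sum -sumrB big1 // => i _.
  rewrite coefCM coefXnM ltnNge leq_subr /= subKn //.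
  by have [_ _ ->] := hf i; rewrite subrr.
have pj' : p`_j = 0 by rewrite nth_default // [X in (X <= _)%N]sp.
rewrite coefB pj' sub0r coef_sum big1 ?oppr0 // => i _.
rewrite coefCM coefXnM; case: ifP => _; first by rewrite mulr0.
have [_ si _] := hf i; rewrite nth_default ?mulr0 //.
apply: leq_trans si _; rewrite ltn_subRL.
by rewrite subnK.
Qed.

(** * The polynomial ring modulo its first variable *)

Section PolynomialLift.
Variables (K : fieldType) (n : nat).

(** A ring section of [mred]: it serves as [lft] in the change of rings. *)
Definition mlift (g : {mpoly K[n]}) : {mpoly K[n.+1]} :=
  g \mPo [tuple 'X_(lift ord0 j) | j < n].

HB.instance Definition _ := GRing.RMorphism.copy mlift
  (comp_mpoly [tuple 'X_(lift ord0 j) | j < n]).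

Fact mred_additive : additive (@mred K n).
Proof. by move=> f g; rewrite /mred rmorphB. Qed.
Fact mred_multiplicative : multiplicative (@mred K n).
Proof. by split=> [f g|]; rewrite /mred ?rmorphM ?rmorph1. Qed.

HB.instance Definition _ :=
  GRing.isAdditive.Build {mpoly K[n.+1]} {mpoly K[n]} (@mred K n) mred_additive.
HB.instance Definition _ :=
  GRing.isMultiplicative.Build {mpoly K[n.+1]} {mpoly K[n]} (@mred K n)
    mred_multiplicative.

Lemma mliftX j : mlift 'X_j = 'X_(lift ord0 j).
Proof. by rewrite /mlift comp_mpolyXU -tnth_nth tnth_mktuple. Qed.

Lemma mliftC c : mlift c%:MP = c%:MP.
Proof. exact: comp_mpolyC. Qed.

Lemma mredC c : mred (c%:MP : {mpoly K[n.+1]}) = c%:MP.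
Proof. exact: comp_mpolyC. Qed.

Lemma mredX_lift j : mred ('X_(lift ord0 j) : {mpoly K[n.+1]}) = 'X_j.
Proof. by rewrite mredX liftK. Qed.

Lemma mredX0 : mred ('X_ord0 : {mpoly K[n.+1]}) = 0.
Proof. by rewrite mredX unlift_none. Qed.

End PolynomialLift.

Lemma mpoly_ring_ind (K : fieldType) (n : nat) (P : {mpoly K[n]} -> Prop) :
  (forall c, P c%:MP) -> (forall i, P 'X_i) ->
  (forall p q, P p -> P q -> P (p + q)) ->
  (forall p q, P p -> P q -> P (p * q)) -> forall p, P p.
Proof.
move=> PC PX PD PM; elim/mpolyind => [|c m p _ _ Pp].
  by rewrite -mpolyC0; apply: PC.
apply: (PD) => //; rewrite -mul_mpolyC; apply: (PM) => //.
rewrite mpolyXE_id; elim/big_ind: _ => [||i _]; [|exact: PM|].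
  by rewrite -mpolyC1; apply: PC.
elim: (m i) => [|k IH]; first by rewrite expr0 -mpolyC1; apply: PC.
by rewrite exprS; apply: PM.
Qed.

Lemma mliftK (K : fieldType) n : cancel (@mlift K n) (@mred K n).
Proof.
elim/mpoly_ring_ind => [c|i|p q hp hq|p q hp hq].
- by rewrite mliftC mredC.
- by rewrite mliftX mredX_lift.
- by rewrite !rmorphD /= hp hq.
- by rewrite !rmorphM /= hp hq.
Qed.

(** Sending X to the first variable makes the ring in n + 1 variables a quotient of polynomials over
    the ring in n variables; surjectivity is enough. In no variables every nonzero element is a
    unit. *)
Lemma noetherian_mpoly (K : fieldType) n : noetherian {mpoly K[n]}.
Proof.
elim: n => [|n IH].
  apply: noetherian_ideals => I hI.
  have [[p Ip p0]|nI] := classic (exists2 p, I p & p <> 0); last first.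
    exists 0%N, (fun _ => 0) => w; split=> [Iw|[c ->]].
      exists (fun _ => 0); rewrite big_ord0; have [//|w0] := classic (w = 0).
      by case: nI; exists w.
    by rewrite big_ord0; case: hI.
  exists 1%N, (fun _ => 1) => w; split=> [_|_].
    by exists (fun _ => w); rewrite big_ord1; symmetry; apply: mulr1.
  have pC := nvar0_mpolyC p; pose c := p@_0%MM.
  have c0 : c != 0 by apply/eqP => c0; apply: p0; rewrite pC -/c c0 mpolyC0.
  have -> : w = (w * (c^-1)%:MP) *: (p : {mpoly K[0]}^o).
    rewrite -[RHS]/(w * (c^-1)%:MP * p) pC -mulrA -mpolyCM mulVf //.
    by rewrite mpolyC1 mulr1.
  exact: submodZ.
pose f (p : {poly {mpoly K[n]}}) := horner_eval ('X_ord0) (map_poly (@mlift K n) p).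
pose g : {rmorphism {poly {mpoly K[n]}} -> {mpoly K[n.+1]}} :=
  GRing.RMorphism.clone _ _ f
   (horner_eval ('X_ord0) \o map_poly (@mlift K n)).
apply: (noetherian_surj (f := g)); last exact: hilbert_basis.
elim/mpoly_ring_ind => [c|i|p q [u <-] [v <-]|p q [u <-] [v <-]].
- by exists (c%:MP)%:P; rewrite /= /f map_polyC /horner_eval hornerC /= mliftC.
- case: (unliftP ord0 i) => [j|] ->.
    by exists ('X_j)%:P; rewrite /= /f map_polyC /horner_eval hornerC /= mliftX.
  by exists 'X; rewrite /= /f map_polyX /horner_eval hornerX.
- by exists (u + v); rewrite rmorphD.
- by exists (u * v); rewrite rmorphM.
Qed.

(** * Finite bases of free submodules *)

Section FreeModules.
Variable R : comNzRingType.

(** The basis [B] may a priori be infinite; the finitely many elements of it occurring in a finite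
    generating family already span. *)
Lemma free_fin_basis (W : lmodType R) (M : W -> Prop) :
  free_submod M -> fin_gen M ->
  exists q (j : {linear 'rV[R]_q -> W}),
    (forall u, j u = 0 -> u = 0) /\ forall w, M w <-> exists u, j u = w.
Proof.
move=> [B [BM gB fB]] [t [g gM]].
have hM : submod M.
  have hI := submod_image (comb g); move/generatesP: gM => gM.
  by split=> [|a u v /gM hu /gM hv]; apply/gM; [case: hI|apply: hI.2].
have [sc hsc] := choice (fun i (sc : seq W * (W -> R)) =>
  (forall v, v \in sc.1 -> B v) /\ g i = \sum_(v <- sc.1) sc.2 v *: v)
  (fun i => let: ex_intro s (ex_intro c h) := gB _ (generates_gen i gM) in
            ex_intro _ (s, c) h).
pose s := undup (flatten [seq (sc i).1 | i <- enum 'I_t]).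
have Bs v : v \in s -> B v.
  by rewrite mem_undup => /flatten_mapP[i _]; apply: (hsc i).1.
have us : uniq s by apply: undup_uniq.
exists (size s), (comb (tnth (in_tuple s))); split=> [u u0|w].
  pose c v := if insub (index v s) is Some i then u 0 i else 0.
  have cE i : c (tnth (in_tuple s) i) = u 0 i.
    rewrite /c (tnth_nth 0) /= index_uniq // insubT // => lt.
    by congr (u 0 _); apply: val_inj.
  apply/rowP => i; rewrite mxE -cE; apply: (fB s c) => //; last exact: mem_tnth.
  rewrite -[RHS]u0 /comb (big_tnth _ _ s); apply: eq_bigr => k _.
  by rewrite cE.
split=> [/gM[c ->]|[u <-]]; last first.
  by apply: submod_sum => // i _; apply: submodZ => //; apply/BM/Bs/mem_tnth.
pose I w := exists u, comb (tnth (in_tuple s)) u = w.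
have hI : submod I by apply: submod_image.
apply: (submod_sum (M := I)) => // i _; apply: submodZ => //.
rewrite (hsc i).2 big_seq; apply: submod_sum => // v vs; apply: submodZ => //.
have : v \in s by rewrite mem_undup; apply/flatten_mapP; exists i; rewrite ?mem_enum.
by case/(tnthP (in_tuple s))=> k ->; exists (delta_mx 0 k); rewrite comb_delta.
Qed.

Lemma generates_drop (W : lmodType R) (M : W -> Prop) s (g : 'I_s.+1 -> W) j b :
  generates M g -> g j = \sum_(i < s) b i *: g (lift j i) ->
  generates M (fun i => g (lift j i)).
Proof.
move=> gM gj w; rewrite gM; split=> [[f ->]|[f ->]].
  exists (fun i => f j * b i + f (lift j i)).
  rewrite (bigD1_ord j) //= gj scaler_sumr -big_split; apply: eq_bigr => i _.
  by rewrite /= scalerA scalerDl.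
exists (fun i => if unlift j i is Some k then f k else 0).
rewrite (bigD1_ord j) //= unlift_none scale0r add0r; apply: eq_bigr => i _.
by rewrite liftK.
Qed.

(** Coefficients in [is_basis] are functions on W, so the index of a basis vector has to be
    recovered from the vector; the images of the unit vectors are distinct since the ring is
    nonzero. *)
Lemma injective_free_submod (W : lmodType R) (M : W -> Prop) q
    (j : {linear 'rV[R]_q -> W}) :
  (forall u, j u = 0 -> u = 0) -> (forall w, M w <-> exists u, j u = w) ->
  free_submod M.
Proof.
move=> inj jM; exists (fun v => exists i, v = j (delta_mx 0 i)); split.
- by move=> _ [i ->]; apply/jM; exists (delta_mx 0 i).
- move=> w /jM[u <-]; exists [seq j (delta_mx 0 i) | i <- enum 'I_q].
  have [idx hidx] : exists idx : W -> option 'I_q,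
      forall i, idx (j (delta_mx 0 i)) = Some i.
    have dinj i k : j (delta_mx 0 i) = j (delta_mx 0 k) -> i = k.
      move=> /eqP; rewrite -subr_eq0 -linearB => /eqP/inj/eqP.
      rewrite subr_eq0 => /eqP/rowP/(_ i); rewrite !mxE !eqxx /=.
      by case: eqP => // _ /eqP; rewrite oner_eq0.
    have [idx hidx] := choice (fun w o => forall i, w = j (delta_mx 0 i) -> o = Some i)
      (fun w => match classic (exists i, w = j (delta_mx 0 i)) with
       | or_introl (ex_intro i h) => ex_intro _ (Some i)
           (fun k hk => congr1 Some (dinj i k (etrans (esym h) hk)))
       | or_intror h => ex_intro _ None (fun k hk => False_ind _ (h (ex_intro _ k hk)))
       end).
    by exists idx => i; apply: hidx.
  exists (fun v => if idx v is Some i then u 0 i else 0); split.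
    by move=> v /mapP[i _ ->]; exists i.
  rewrite linear_combE /comb big_map big_enum; apply: eq_bigr => i _.
  by rewrite hidx.
move=> s c us sB s0 v vs.
have [idx hidx] : exists idx : W -> 'I_q, forall v, v \in s -> v = j (delta_mx 0 (idx v)).
  apply: (choice (fun v i => v \in s -> v = j (delta_mx 0 i))) => w.
  have [/sB[i ->]|_] := boolP (w \in s); first by exists i.
  by have [i _] := sB v vs; exists i.
have : \sum_(w <- s) c w *: delta_mx 0 (idx w) = 0 :> 'rV[R]_q.
  apply: inj; rewrite -[RHS]s0 linear_sum big_seq [RHS]big_seq.
  by apply: eq_bigr => w ws; rewrite linearZ /= -hidx.
move/rowP/(_ (idx v)); rewrite summxE mxE (bigD1_seq v) //= !mxE !eqxx mulr1.
rewrite big_seq_cond big1 ?addr0 // => w /andP[ws wv].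
rewrite !mxE /=; case: eqP => [E|]; last by rewrite mulr0.
by case/eqP: wv; rewrite (hidx _ ws) (hidx _ vs) E.
Qed.

End FreeModules.

(** * Relations in a free module modulo x *)

Section RegularSequence.
Variables (R Rb : comNzRingType) (red : {rmorphism R -> Rb}).
Variables (lft : {rmorphism Rb -> R}) (x : R).
Hypothesis lftK : cancel lft red.
Hypothesis red_eq0 : forall a, red a = 0 <-> exists c, a = x * c.
Hypothesis x_regular : forall a, x * a = 0 -> a = 0.

(* If red F, red G is a regular sequence then so is F, G, x; hence x is regular
   on D / (F, G) D for D free. *)
Lemma free_regular_sequence (W : lmodType R) (D : W -> Prop) (F G : R) u v m :
  free_submod D -> fin_gen D ->
  (forall s t, red F * s = red G * t -> exists r, s = red G * r) ->
  injective ( *%R (red G)) ->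
  D u -> D v -> D m -> x *: m = G *: u - F *: v ->
  exists m1 m2, [/\ D m1, D m2 & m = G *: m1 - F *: m2].
Proof.
move=> fD fgD cop Ginj; have [q [j [jinj jD]]] := free_fin_basis fD fgD.
move=> /jD[cu <-] /jD[cv <-] /jD[cm <-] E.
have {}E : x *: cm = G *: cu - F *: cv.
  apply/subr0_eq/jinj.
  by rewrite linearB [j (_ - _)]linearB ![j (_ *: _)]linearZ /= E subrr.
have redx : red x = 0 by apply/red_eq0; exists 1; rewrite mulr1.
have [c hc] : exists c : 'I_q -> R * R,
    forall i, cm 0 i = G * (c i).1 - F * (c i).2.
  apply: (choice (fun i c => cm 0 i = G * c.1 - F * c.2)) => i.
  have := congr1 (fun w : 'rV[R]_q => w 0 i) E; rewrite !mxE => Ei.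
  have := congr1 red Ei; rewrite rmorphB !rmorphM redx mul0r => /esym/eqP.
  (* In each coordinate u = F s and v = G s modulo x, with a common s. In G u - F v the terms F G s
     cancel, and x times G c1 - F c2 is left. *)
  rewrite subr_eq0 => /eqP/esym Er; have [s hs] := cop _ _ Er.
  have us : red (cu 0 i) = red F * s.
    by apply: Ginj; rewrite -Er hs mulrCA.
  have [c1 h1] : exists c1, cu 0 i - F * lft s = x * c1.
    by apply/red_eq0; rewrite rmorphB rmorphM lftK us subrr.
  have [c2 h2] : exists c2, cv 0 i - G * lft s = x * c2.
    by apply/red_eq0; rewrite rmorphB rmorphM lftK hs subrr.
  exists (c1, c2); apply/subr0_eq/x_regular; rewrite mulrBr Ei /=.
  rewrite -[cu 0 i](subrK (F * lft s)) -[cv 0 i](subrK (G * lft s)) h1 h2.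
  ring.
exists (j (\row_i (c i).1)), (j (\row_i (c i).2)); split.
- by apply/jD; exists (\row_i (c i).1).
- by apply/jD; exists (\row_i (c i).2).
rewrite -![_ *: j _]linearZ -linearB; congr (j _); apply/rowP => i.
by rewrite !mxE hc.
Qed.

End RegularSequence.

(* A section of comb g gives a square matrix E with E = 1 modulo ker ev, so E is
   injective; but E kills the relations. *)
Lemma projective_minimal_free (R : idomainType) (F : fieldType)
    (ev : {rmorphism R -> F}) (W : lmodType R) (M : W -> Prop) s
    (g : 'I_s -> W) :
  pd_le M 0 -> generates M g ->
  (forall u j, comb g u = 0 -> ev (u 0 j) = 0) ->
  forall u, comb g u = 0 -> u = 0.
Proof.
move=> pM /generatesP gM rel u u0.
have Mg v : M (comb g v) by apply/gM; exists v.
have [sg lsg gsg] := pd_le0_section pM gM.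
have hM := pd_le_submod pM.
have le : linear (fun v => sg (comb g v)).
  by move=> a v w; rewrite linearP; apply: lsg; apply: Mg.
pose E := lin1_mx (mklin le).
have EE v : v *m E = sg (comb g v) by rewrite mul_rV_lin1.
have E0 : map_mx ev E = 1%:M.
  apply/matrixP => i j.
  (* A unit vector minus its image under [E] is a relation, because [sg] is a section of
     [comb g]. *)
  have := rel (delta_mx 0 i - delta_mx 0 i *m E) j.
  rewrite linearB /= EE gsg // subrr => /(_ erefl).
  rewrite -EE -rowE mxE [X in _ + X]mxE !mxE eqxx /= => /eqP.
  by rewrite rmorphB subr_eq0 => /eqP <-; rewrite rmorph_nat eq_sym.
have detE : \det E != 0.
  apply/eqP => E'; have := det_map_mx ev E.
  by rewrite E0 E' det1 rmorph0 => /eqP; rewrite oner_eq0.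
have uE : u *m E = 0 by rewrite EE u0 (linear_on0 hM lsg).
have : \det E *: u = 0 by rewrite -mul_mx_scalar -mul_mx_adj mulmxA uE mul0mx.
move/rowP=> h; apply/rowP => i; have := h i; rewrite !mxE => /eqP.
by rewrite mulf_eq0 (negPf detE) => /eqP.
Qed.

(** * Graded modules of polynomial vectors *)

Section GradedModules.
Variables (K : fieldType) (m : nat) (T : finType).
Local Notation S := {mpoly K[m]}.
Local Notation W := {ffun T -> S^o}.

Lemma pihomogM d e (c h : S) : h \is e.-homog ->
  pihomog mdeg d (c * h) = if (e <= d)%N then pihomog mdeg (d - e) c * h else 0.
Proof.
move=> he; elim/mpolyind: c => [|a k p _ _ IH].
  by rewrite mul0r !pihomog0 mul0r; case: ifP.
rewrite mulrDl !linearD /= IH -scalerAl !linearZ /= pihomogX.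
have hX : 'X_[k] * h \is (mdeg k + e).-homog by rewrite dhomogM // dhomogX.
have [E|ne] := eqVneq (mdeg k + e)%N d.
  by rewrite -E leq_addl addnK eqxx (pihomog_dE (mf := mdeg)) // mulrDl scalerAl.
rewrite (pihomog_ne0 ne hX) scaler0 add0r; case: ifP => // ed.
rewrite ifN ?scaler0 ?add0r //.
by apply: contra ne => /eqP ->; rewrite subnK.
Qed.

Lemma pihomog_deg0 (p : S) : pihomog mdeg 0 p = (p@_0%MM)%:MP.
Proof.
elim/mpolyind: p => [|a k p _ _ IH]; first by rewrite pihomog0 mcoeff0 mpolyC0.
rewrite linearP /= IH pihomogX mdeg_eq0 mcoeffD mcoeffZ mcoeffX mpolyCD.
case: eqP => [->|_]; last by rewrite scaler0 mulr0 mpolyC0.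
by rewrite mulr1 mpolyX0 -mul_mpolyC mulr1.
Qed.

Lemma ffunZE (c : S) (w : W) t : (c *: w) t = c * w t.
Proof. by rewrite ffunE. Qed.

Definition hcomp (d : nat) (w : W) : W := [ffun t => pihomog mdeg d (w t)].

Definition graded (M : W -> Prop) : Prop := forall d w, M w -> M (hcomp d w).

Lemma hcompZ d e (c : S) w : hcomp e w = w ->
  hcomp d (c *: w) = (if (e <= d)%N then pihomog mdeg (d - e) c else 0) *: w.
Proof.
move=> we; apply/ffunP => t; rewrite [LHS]ffunE !ffunZE.
have wt : w t \is e.-homog.
  by have := congr1 (fun f : W => f t) we; rewrite ffunE => <-; apply: pihomogP.
rewrite (pihomogM d c wt); case: ifP => _ //.
by rewrite mul0r.
Qed.

Lemma hcomp_sum d n (F : 'I_n -> W) : hcomp d (\sum_i F i) = \sum_i hcomp d (F i).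
Proof.
apply/ffunP => t; rewrite !ffunE sum_ffunE linear_sum sum_ffunE.
by apply: eq_bigr => i _; rewrite ffunE.
Qed.

Definition homog_generates (M : W -> Prop) s : Prop :=
  exists (g : 'I_s -> W) (d : 'I_s -> nat),
    generates M g /\ forall i, hcomp (d i) (g i) = g i.

Lemma graded_homog_generates M :
  graded M -> fin_gen M -> exists s, homog_generates M s.
Proof.
move=> grM [s [g gM]].
pose k := (\max_i \max_t msize (g i t))%N.
have gE i : g i = \sum_(d < k) hcomp d (g i).
  apply/ffunP => t; rewrite sum_ffunE.
  under eq_bigr do rewrite ffunE.
  apply: pihomog_partitionE; rewrite -/(msize _).
  exact: leq_trans (leq_bigmax t) (leq_bigmax i).
pose I := ('I_s * 'I_k)%type.
pose h (a : I) := hcomp a.2 (g a.1).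
exists #|{: I}|, (fun a => h (enum_val a)), (fun a => nat_of_ord (enum_val a).2); split.
  have hM : submod M.
    have hI := submod_image (comb g); move/generatesP: gM => gM.
    by split=> [|a u v /gM hu /gM hv]; apply/gM; [case: hI|apply: hI.2].
  apply/generatesP => w; split=> [/gM[c ->]|[u <-]]; last first.
    apply: submod_sum => // i _; apply: submodZ => //.
    by apply/grM/(generates_gen _ gM).
  set hh := fun a => h (enum_val a).
  pose J w := exists u, comb hh u = w.
  have hJ : submod J by apply: submod_image.
  apply: (submod_sum (M := J)) => // i _; apply: submodZ => //; rewrite gE.
  apply: submod_sum => // d _; exists (delta_mx 0 (enum_rank ((i, d) : I))).
  by rewrite comb_delta /hh enum_rankK.
move=> a; apply/ffunP => t; rewrite !ffunE; apply: pihomog_id.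
Qed.

(* Graded Nakayama: if the j-th coefficient has a nonzero constant term, the
   component of degree d j of the relation expresses g j by the others. *)
Lemma minimal_homog_relation M s (g : 'I_s -> W) (d : 'I_s -> nat) :
  generates M g -> (forall i, hcomp (d i) (g i) = g i) ->
  (forall t, homog_generates M t -> (s <= t)%N) ->
  forall u j, comb g u = 0 -> (u 0 j)@_0%MM = 0.
Proof.
case: s g d => [|s] g d; first by move=> _ _ _ u [].
move=> gM gd smin u j u0; apply/eqP/negPn/negP => cj.
pose a := (u 0 j)@_0%MM.
pose c i := if (d i <= d j)%N then pihomog mdeg (d j - d i) (u 0 i) else 0.
have cE : \sum_i c i *: g i = 0.
  have := congr1 (hcomp (d j)) u0; rewrite hcomp_sum.
  have -> : hcomp (d j) 0 = 0 by apply/ffunP => t; rewrite !ffunE pihomog0.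
  move=> E; rewrite -[RHS]E; apply: eq_bigr => i _.
  by rewrite (hcompZ (d j) (u 0 i) (gd i)).
have cjE : c j = a%:MP.
  by rewrite /c leqnn subnn pihomog_deg0.
pose b i := - (a^-1)%:MP * c (lift j i).
have gj : g j = \sum_(i < s) b i *: g (lift j i).
  move: cE; rewrite (bigD1_ord j) //= cjE => /eqP; rewrite addr_eq0 => /eqP E.
  have -> : g j = (a^-1)%:MP *: (a%:MP *: g j).
    by rewrite scalerA -mpolyCM mulVf // mpolyC1 scale1r.
  rewrite E scalerN scaler_sumr -sumrN; apply: eq_bigr => i _.
  by rewrite scalerA -scaleNr /b mulNr.
have hg : homog_generates M s.
  exists (fun i => g (lift j i)), (fun i => d (lift j i)); split=> //.
  exact: generates_drop gM gj.
by have := smin _ hg; rewrite ltnn.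
Qed.

(** In a homogeneous generating family of least size all relations have zero constant terms; taking
    constant terms is then the morphism [ev] of [projective_minimal_free]. *)
Lemma graded_projective_free M :
  graded M -> fin_gen M -> pd_le M 0 -> free_submod M.
Proof.
move=> grM fgM pM.
have [s hs smin] : exists2 s, homog_generates M s &
    forall t, homog_generates M t -> (s <= t)%N.
  have [s] := graded_homog_generates grM fgM.
  elim/ltn_ind: s => s IH hs.
  have [[t ts ht]|h] := classic (exists2 t, (t < s)%N & homog_generates M t).
    exact: IH ht.
  exists s => // t ht; rewrite leqNgt; apply/negP => ts.
  by apply: h; exists t.
have [g [d [gM gd]]] := hs.
have rel := minimal_homog_relation gM gd smin.
apply: (injective_free_submod (j := comb g)); last exact/generatesP.
exact: (projective_minimal_free (ev := mcoeff 0%MM) pM gM rel).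
Qed.

End GradedModules.

(** * Exterior multiplication by a 1-form *)

Section Wedge.
Variable R : comNzRingType.

(* Coefficient at dx_I of t /\ (sum_i a_i dx_i). *)
Definition wed m (a : 'I_m -> R) (t : {set 'I_m} -> R) (I : {set 'I_m}) : R :=
  \sum_(i in I) (-1) ^+ #|[set j in I | (i < j)%N]| * a i * t (I :\ i).

Lemma eq_wed m (a b : 'I_m -> R) (t s : {set 'I_m} -> R) I :
  a =1 b -> t =1 s -> wed a t I = wed b s I.
Proof. by move=> ab ts; apply: eq_bigr => i _; rewrite ab ts. Qed.

Lemma wedD m (a : 'I_m -> R) c (t s : {set 'I_m} -> R) I :
  wed a (fun J => c * t J + s J) I = c * wed a t I + wed a s I.
Proof.
rewrite /wed mulr_sumr -big_split; apply: eq_bigr => i _ /=.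
by rewrite mulrDr [_ * (c * _)]mulrCA.
Qed.

Lemma wed0 m (a : 'I_m -> R) I : wed a (fun _ => 0) I = 0.
Proof. by rewrite /wed big1 // => i _; rewrite mulr0. Qed.

Lemma wedZ m (a : 'I_m -> R) c (t : {set 'I_m} -> R) I :
  wed a (fun J => c * t J) I = c * wed a t I.
Proof.
rewrite /wed mulr_sumr; by apply: eq_bigr => i _; rewrite mulrCA.
Qed.

Lemma wedZl m (a : 'I_m -> R) c (t : {set 'I_m} -> R) I :
  wed (fun i => c * a i) t I = c * wed a t I.
Proof.
by rewrite /wed mulr_sumr; apply: eq_bigr => i _; rewrite !mulrA [c * _]mulrC.
Qed.

Lemma wed_deg m (a : 'I_m -> R) (t : {set 'I_m} -> R) (p : int) :
  (forall I : {set 'I_m}, #|I|%:Z != p -> t I = 0) ->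
  forall I : {set 'I_m}, #|I|%:Z != p + 1 -> wed a t I = 0.
Proof.
move=> ht I hI; rewrite /wed big1 // => i iI; rewrite ht ?mulr0 //.
apply: contra hI => /eqP <-; rewrite (cardsD1 i I) iI addnC.
by rewrite PoszD.
Qed.

(** Index sets without dx_1 ([lset]) and with dx_1 ([zset]), both indexed by sets of the remaining
    coordinates. *)
Definition lset n (J : {set 'I_n}) : {set 'I_n.+1} := lift ord0 @: J.
Definition zset n (J : {set 'I_n}) : {set 'I_n.+1} := ord0 |: lset J.

Lemma lset0 n (J : {set 'I_n}) : ord0 \notin lset J.
Proof. by apply/imsetP => -[j _ /eqP]; rewrite (negPf (neq_lift _ _)). Qed.

Lemma mem_lset n (J : {set 'I_n}) j : (lift ord0 j \in lset J) = (j \in J).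
Proof. by rewrite mem_imset //; apply: lift_inj. Qed.

Lemma mem_zset n (J : {set 'I_n}) j : (lift ord0 j \in zset J) = (j \in J).
Proof. by rewrite !inE eq_sym (negPf (neq_lift _ _)) mem_lset. Qed.

Lemma card_lset n (J : {set 'I_n}) : #|lset J| = #|J|.
Proof. by rewrite card_imset //; apply: lift_inj. Qed.

Lemma card_zset n (J : {set 'I_n}) : #|zset J| = #|J|.+1.
Proof. by rewrite cardsU1 lset0 card_lset. Qed.

Lemma set_ord0P n (I : {set 'I_n.+1}) :
  exists J, I = if ord0 \in I then zset J else lset J.
Proof.
exists [set j | lift ord0 j \in I]; apply/setP => i.
case: (unliftP ord0 i) => [j|] ->.
  by case: ifP => _; rewrite ?mem_zset ?mem_lset inE.
by case: ifP => _; rewrite ?setU11 ?(negPf (lset0 _)).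
Qed.

Section Split.
Variables (n : nat) (a : 'I_n.+1 -> R) (t : {set 'I_n.+1} -> R).

(** In t = t_0 /\ dx_1 + t_1, these are the coefficients of t_0 and t_1. The sign comes from moving
    dx_1 past dx_J. *)
Definition part0 (J : {set 'I_n}) : R := (-1) ^+ #|J| * t (zset J).
Definition part1 (J : {set 'I_n}) : R := t (lset J).

Let ltlift (J : {set 'I_n}) (i : 'I_n) (I : {set 'I_n.+1}) :
  (forall j, (lift ord0 j \in I) = (j \in J)) ->
  #|[set j in I | (lift ord0 i < j)%N]| = #|[set j in J | (i < j)%N]|.
Proof.
move=> IJ; rewrite -[RHS]card_lset; apply: eq_card => j; rewrite inE.
case: (unliftP ord0 j) => [k|] ->; last by rewrite (negPf (lset0 _)) ltn0 andbF.
by rewrite mem_lset inE IJ /= /bump !leq0n !add1n ltnS.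
Qed.

Lemma wed_lset (J : {set 'I_n}) : wed a t (lset J) = wed (fun i => a (lift ord0 i)) part1 J.
Proof.
rewrite /wed big_imset /=; last by move=> ? ? _ _; apply: lift_inj.
apply: eq_bigr => i iJ; rewrite (ltlift _ (mem_lset J)); congr (_ * t _).
apply/setP => k; rewrite !inE; case: (unliftP ord0 k) => [j|] ->.
  by rewrite !mem_lset !inE (inj_eq lift_inj).
by rewrite !(negPf (lset0 _)) andbF.
Qed.

(** This is the coefficient of dx_J /\ dx_1 in (t_0 /\ dx_1 + t_1) /\ a; the minus sign comes from
    moving the rest of a past dx_1. *)
Lemma wed_zset (J : {set 'I_n}) : (-1) ^+ #|J| * wed a t (zset J) =
  a ord0 * part1 J - wed (fun i => a (lift ord0 i)) part0 J.
Proof.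
rewrite /wed big_setU1 ?lset0 //= mulrDr; congr (_ + _).
  have -> : #|[set j in zset J | ((@ord0 n) < j)%N]| = #|J|.
    rewrite -[RHS]card_lset; apply: eq_card => j; rewrite inE.
    case: (unliftP ord0 j) => [k|] ->; first by rewrite mem_zset mem_lset andbT.
    by rewrite ltnn andbF (negPf (lset0 _)).
  rewrite !mulrA -exprD addnn -mul2n exprM sqrrN !expr1n mul1r.
  by congr (_ * t _); rewrite setU1K ?lset0.
rewrite big_imset /=; last by move=> ? ? _ _; apply: lift_inj.
rewrite mulr_sumr -sumrN; apply: eq_bigr => i iJ.
rewrite (ltlift _ (mem_zset J)).
have -> : zset J :\ lift ord0 i = zset (J :\ i).
  apply/setP => k; rewrite in_setD1; case: (unliftP ord0 k) => [j|] ->.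
    by rewrite !mem_zset in_setD1 (inj_eq lift_inj).
  by rewrite !setU11 neq_lift.
rewrite /part0 (cardsD1 i J) iJ add1n exprS.
by rewrite mulN1r mulNr mulrCA.
Qed.

End Split.

(** Induction on the number of coordinates replaces the pairing of terms of opposite sign: after
    splitting off dx_1, the two terms containing a_1 cancel and the others are zero by induction. *)
Lemma wed_wed m (a : 'I_m -> R) (t : {set 'I_m} -> R) I :
  wed a (wed a t) I = 0.
Proof.
elim: m a t I => [|n IH] a t I; first by rewrite /wed big1 // => -[].
have [J ->] := set_ord0P I; case: ifP => _; last first.
  rewrite wed_lset -[RHS](IH (fun i => a (lift ord0 i)) (part1 t) J).
  by apply: eq_wed => // L; rewrite /part1 wed_lset.
have sgn (x : R) k : (-1) ^+ k * x = 0 -> x = 0.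
  move/(congr1 ( *%R ((-1) ^+ k))).
  by rewrite mulrA -exprD addnn -mul2n exprM sqrrN !expr1n mul1r mulr0.
apply: (sgn _ #|J|); rewrite wed_zset.
rewrite (eq_wed (s := fun L => -1 * wed (fun i => a (lift ord0 i)) (part0 t) L
  + a ord0 * part1 t L) _ (fun=> erefl)); last first.
  by move=> L; rewrite /part0 wed_zset mulN1r addrC.
by rewrite wedD IH mulr0 add0r wedZ /part1 wed_lset subrr.
Qed.

End Wedge.

Lemma rmorph_wed (R R' : comNzRingType) (f : {rmorphism R -> R'}) m
    (a : 'I_m -> R) (t : {set 'I_m} -> R) I :
  f (wed a t I) = wed (f \o a) (f \o t) I.
Proof.
rewrite /wed rmorph_sum; apply: eq_bigr => i _.
by rewrite !rmorphM rmorphXn rmorphN1.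
Qed.

(** * Divisibility by linear forms *)

Section LinearForms.
Variables (K : fieldType) (m : nat).
Local Notation S := {mpoly K[m]}.
Implicit Types f g h : S.

Definition mdvd f g : Prop := exists h, g = f * h.

Lemma mdvd0 f : mdvd f 0. Proof. by exists 0; rewrite mulr0. Qed.
Lemma mdvdD f g h : mdvd f g -> mdvd f h -> mdvd f (g + h).
Proof. by move=> [u ->] [v ->]; exists (u + v); rewrite mulrDr. Qed.
Lemma mdvdMl f g h : mdvd f g -> mdvd f (h * g).
Proof. by move=> [u ->]; exists (h * u); rewrite mulrCA. Qed.
Lemma mdvdMr f g h : mdvd f g -> mdvd f (g * h).
Proof. by move=> [u ->]; exists (u * h); rewrite mulrA. Qed.
Lemma mdvd_refl f : mdvd f f. Proof. by exists 1; rewrite mulr1. Qed.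
Lemma mdvdN f g : mdvd f g -> mdvd f (- g).
Proof. by rewrite -mulN1r; apply: mdvdMl. Qed.

Definition mprime f : Prop :=
  [/\ f != 0, ~ mdvd f 1
    & forall g h, mdvd f (g * h) -> mdvd f g \/ mdvd f h].

Definition lform (a : 'I_m -> K) : S := \sum_i a i *: 'X_i.

Lemma lform_coef a i : (lform a)@_U_(i) = a i.
Proof.
rewrite /lform raddf_sum (bigD1 i) //= big1 => [|j ji].
  by rewrite mcoeffZ mcoeffXU eqxx mulr1 addr0.
by rewrite mcoeffZ mcoeffXU (negPf ji) mulr0.
Qed.

Lemma meval_lform a v : (lform a).@[v] = \sum_i a i * v i.
Proof.
by rewrite /lform raddf_sum; apply: eq_bigr => i _; rewrite /= mevalZ mevalXU.
Qed.

Lemma homog1_lform f : f \is 1.-homog -> f = lform (fun i => f@_U_(i)).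
Proof.
move=> /dhomogP hf; apply/mpolyP => k.
have [/mdeg1P[i /eqP ->]|nk] := boolP (mdeg k == 1%N).
  by rewrite lform_coef.
rewrite memN_msupp_eq0; last by apply: contra nk => /hf ->.
rewrite /lform raddf_sum big1 // => i _; rewrite /= mcoeffZ mcoeffX.
case: eqP => [E|_]; last by rewrite mulr0.
by rewrite -E mdeg1 eqxx in nk.
Qed.

(** The substitution [sub] eliminates x_i by means of the form itself. It is a ring morphism into a
    domain and f - sub f is divisible by the form, so divisibility of f means sub f = 0. *)
Lemma lform_prime a i : a i != 0 -> mprime (lform a).
Proof.
move=> ai; pose al := lform a.
pose sub f : S := f \mPo [tuple 'X_j - (if j == i then (a i)^-1 *: al else 0) | j < m].
have subX j : sub 'X_j = 'X_j - (if j == i then (a i)^-1 *: al else 0).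
  by rewrite /sub comp_mpolyXU -tnth_nth tnth_mktuple.
have sub_al : sub al = 0.
  rewrite /al /lform /sub raddf_sum /=.
  rewrite (eq_bigr (fun j => a j *: 'X_j -
    (if j == i then al else 0))) => [|j _].
    rewrite sumrB -/(lform a) -/al -big_mkcond big_pred1_eq subrr //.
  rewrite comp_mpolyZ -/(sub _) subX scalerBr; congr (_ - _).
  by case: eqP => [->|_]; rewrite ?scaler0 // scalerA divff // scale1r.
have subD f : mdvd al (f - sub f).
  elim/mpoly_ring_ind: f => [c|j|f g hf hg|f g hf hg].
  - by rewrite /sub comp_mpolyC subrr; apply: mdvd0.
  - rewrite subX subKr; case: eqP => _; last exact: mdvd0.
    by exists ((a i)^-1)%:MP; rewrite mulrC mul_mpolyC.
  - by rewrite /sub rmorphD opprD addrACA; apply: mdvdD.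
  - rewrite /sub rmorphM /= -/(sub f) -/(sub g).
    have -> : f * g - sub f * sub g = f * (g - sub g) + (f - sub f) * sub g by ring.
    by apply: mdvdD; [apply: mdvdMl|apply: mdvdMr].
have dvdE f : mdvd al f <-> sub f = 0.
  split=> [[h ->]|f0]; first by rewrite /sub rmorphM /= -/(sub al) sub_al mul0r.
  by have := subD f; rewrite f0 subr0.
split.
- by apply: contra ai => /eqP al0; rewrite -[a i]lform_coef al0 mcoeff0.
- by move/dvdE/eqP; rewrite /sub rmorph1 oner_eq0.
move=> f g /dvdE; rewrite /sub rmorphM /= -/(sub f) -/(sub g) => /eqP.
by rewrite mulf_eq0 => /orP[]/eqP/dvdE; [left|right].
Qed.

(** If b_j is nonzero, the vector b_j e_i - b_i e_j in the kernel of b gives the ratio a_j / b_j; if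
    b = 0, all vectors are allowed and a = 0. The field may be finite. *)
Lemma lform_proportional (a b : 'I_m -> K) :
  (forall v : 'I_m -> K, \sum_i b i * v i = 0 -> \sum_i a i * v i = 0) ->
  exists c, forall i, a i = c * b i.
Proof.
move=> h; have [[j bj]|nb] := classic (exists j, b j != 0).
  exists (a j / b j) => i.
  have [->|ij] := eqVneq i j; first by rewrite divfK.
  pose v k := if k == i then b j else if k == j then - b i else 0.
  have vE (c : 'I_m -> K) : \sum_k c k * v k = c i * b j - c j * b i.
    rewrite (bigD1 i) //= (bigD1 j) 1?eq_sym //= big1 => [|k /andP[ki kj]].
      by rewrite /v eqxx eq_sym (negPf ij) eqxx addr0 mulrN.
    by rewrite /v (negPf ki) (negPf kj) mulr0.
  have := h v; rewrite !vE [b i * _]mulrC subrr => /(_ erefl)/eqP.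
  rewrite subr_eq0 => /eqP E; apply: (mulIf bj); rewrite E mulrAC divfK //.
exists 0 => i; rewrite mul0r.
have b0 k : b k = 0 by apply/eqP/negPn/negP => bk; apply: nb; exists k.
have := h (fun k => (k == i)%:R); rewrite big1 => [/(_ erefl)|k _]; last by rewrite b0 mul0r.
rewrite (bigD1 i) //= big1 ?eqxx ?mulr1 ?addr0 // => k /negPf ->.
by rewrite mulr0.
Qed.

(** Coprimality as triviality of the relations between f and g, the form needed for regular
    sequences; gcds are avoided. *)
Definition mcoprime f g : Prop := forall u v, f * u = g * v -> mdvd g u.

Lemma mprime_prod f (I : Type) (r : seq I) (P : pred I) (F : I -> S) :
  mprime f -> (forall i, P i -> ~ mdvd f (F i)) ->
  ~ mdvd f (\prod_(i <- r | P i) F i).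
Proof.
by move=> [_ f1 pf] fF; elim/big_ind: _ => // u v hu hv /pf[].
Qed.

(** A prime factor on the left divides g v but not g, hence v; it is cancelled and the next factor
    is treated. *)
Lemma mcoprime_prod g (I : eqType) (r : seq I) (P : pred I) (F : I -> S) :
  (forall i, i \in r -> P i -> mprime (F i) /\ ~ mdvd (F i) g) ->
  mcoprime (\prod_(i <- r | P i) F i) g.
Proof.
elim: r => [|i r IH] hF u v.
  by rewrite big_nil mul1r => ->; exists v.
rewrite big_cons; case: ifP => Pi; last first.
  by apply: IH => k kr; apply: hF; rewrite inE kr orbT.
have [[F0 _ pr] nd] := hF i (mem_head _ _) Pi.
rewrite -mulrA => E; have /pr[//|[w vw]] : mdvd (F i) (g * v).
  by rewrite -E; exists (\prod_(j <- r | P j) F j * u).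
apply: (IH _ _ w) => [k kr|]; first by apply: hF; rewrite inE kr orbT.
by apply: (mulfI F0); rewrite E vw mulrCA.
Qed.

End LinearForms.

Lemma regular_relation (R : comNzRingType) (x F G u v m1 m2 : R) :
  G * u - F * v = x * (G * m1 - F * m2) -> F * (v - x * m2) = G * (u - x * m1).
Proof.
move=> E; have -> : G * (u - x * m1) = G * u - F * v + F * v - x * G * m1 by ring.
by rewrite E; ring.
Qed.

(** * Numerators of logarithmic forms *)

Section PolynomialForms.
Variables (K : fieldType) (m : nat).
Local Notation S := {mpoly K[m]}.

Definition pform := {ffun {set 'I_m} -> S^o}.

Definition cst (a : 'I_m -> K) (i : 'I_m) : S := (a i)%:MP.

Lemma pformP (c : S) (u v : pform) I : (c *: u + v) I = c * u I + v I.
Proof. by rewrite !ffunE. Qed.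

Lemma pformB (u v : pform) I : (u - v) I = u I - v I.
Proof. by rewrite !ffunE. Qed.

Lemma pformBZ (c d : S) (u v : pform) I : (c *: u - d *: v) I = c * u I - d * v I.
Proof. by rewrite pformB !ffunZE. Qed.

(* Numerators of logarithmic p-forms along the hyperplanes lform (a L) = 0. *)
Definition numer (T : Type) (A : T -> Prop) (a : T -> 'I_m -> K) (p : int)
    (t : pform) : Prop :=
  (forall I : {set 'I_m}, #|I|%:Z != p -> t I = 0) /\
  forall L, A L -> forall I, mdvd (lform (a L)) (wed (cst (a L)) t I).

Variables (T : Type) (A : T -> Prop) (a : T -> 'I_m -> K) (p : int).

Lemma wed_pform (b : 'I_m -> S) c (u v : pform) I :
  wed b (c *: u + v) I = c * wed b u I + wed b v I.
Proof. by rewrite -wedD; apply: eq_wed => // J; rewrite pformP. Qed.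

Lemma wed_pformZ (b : 'I_m -> S) c (u : pform) I :
  wed b (c *: u) I = c * wed b u I.
Proof. by rewrite -wedZ; apply: eq_wed => // J; rewrite ffunZE. Qed.

Lemma numer_submod : submod (numer A a p).
Proof.
split=> [|c u v [du hu] [dv hv]].
  split=> [I _|L _ I]; first by rewrite ffunE.
  have -> : wed (cst (a L)) (0 : pform) I = 0.
    by rewrite -[RHS](wed0 (cst (a L)) I); apply: eq_wed => // J; rewrite ffunE.
  exact: mdvd0.
split=> [I hI|L AL I]; first by rewrite pformP du // dv // mulr0 addr0.
by rewrite wed_pform; apply: mdvdD; [apply/mdvdMl/hu|apply: hv].
Qed.

(** Wedging with a constant 1-form preserves polynomial degrees, and the components of a multiple of
    a linear form are multiples of it. *)
Lemma numer_graded : graded (numer A a p).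
Proof.
move=> d t [dt ht]; split=> [I hI|L AL I].
  by rewrite ffunE dt // pihomog0.
have -> : wed (cst (a L)) (hcomp d t) I = pihomog mdeg d (wed (cst (a L)) t I).
  rewrite /wed linear_sum; apply: eq_bigr => i _ /=; rewrite ffunE /cst.
  rewrite -!mulrA !mul_mpolyC -signr_odd; case: odd; rewrite /= ?expr1 ?expr0.
    by rewrite !mulN1r pihomogN; congr (- _); rewrite linearZ.
  by rewrite !mul1r linearZ.
have [h ->] := ht L AL I.
have hl : lform (a L) \is 1.-homog.
  by apply: rpred_sum => i _; apply: rpredZ; rewrite dhomogX; apply/eqP/mdeg1.
rewrite mulrC (pihomogM d h hl); case: ifP => _; last exact: mdvd0.
by apply: mdvdMl; apply: mdvd_refl.
Qed.

Lemma numer_fin_gen : fin_gen (numer A a p).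
Proof.
pose N := #|{: {set 'I_m}}|.
pose f (u : 'rV[S]_N) : pform := [ffun I => u 0 (enum_rank I)].
have lf : linear f.
  by move=> c u v; apply/ffunP => I; rewrite pformP !ffunE !mxE.
apply: (noetherian_fin_gen (f := mklin lf)).
- exact: noetherian_mpoly.
- exact: numer_submod.
move=> w _; exists (\row_i w (enum_val i)); apply/ffunP => I.
by rewrite !ffunE mxE enum_rankK.
Qed.

End PolynomialForms.

(** * The residue on numerators and its surjectivity *)

Section PolynomialResidue.
Variables (K : fieldType) (n : nat) (T T' : eqType).
(** In the application [ls] is A', [xs] is A^H and [rst] L is the intersection of L and H. The
    geometry enters only through the divisibility and proportionality hypotheses below. *)
Variables (ls : seq T) (xs : seq T') (rst : T -> T').
Variables (a : T -> 'I_n.+1 -> K) (b : T' -> 'I_n -> K) (p : int).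
Local Notation S := {mpoly K[n.+1]}.
Local Notation Sb := {mpoly K[n]}.
Local Notation x := ('X_ord0 : S).

Hypothesis xs_uniq : uniq xs.
Hypothesis xsP : forall X, reflect (exists2 L, L \in ls & X = rst L) (X \in xs).
Hypothesis a_prime : forall L, L \in ls -> mprime (lform (a L)).
Hypothesis a_ndvd : forall L L', L \in ls -> L' \in ls -> L != L' ->
  ~ mdvd (lform (a L)) (lform (a L')).
Hypothesis a_ndvdx : forall L, L \in ls -> ~ mdvd (lform (a L)) x.
Hypothesis x_ndvda : forall L, L \in ls -> ~ mdvd x (lform (a L)).
Hypothesis abar_prime : forall L, L \in ls -> mprime (mred (lform (a L))).
Hypothesis abar_ndvd : forall L L', L \in ls -> L' \in ls -> rst L != rst L' ->
  ~ mdvd (mred (lform (a L))) (mred (lform (a L'))).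
Hypothesis a_b : forall L, L \in ls ->
  exists2 c : K, c != 0 & forall i, a L (lift ord0 i) = c * b (rst L) i.

Let e0 (i : 'I_n.+1) : K := (i == ord0)%:R.

Lemma mdvdx f : mdvd x f <-> mred f = 0.
Proof. by split=> /mred_eq0P. Qed.

Lemma lform_e0 : lform e0 = x.
Proof.
rewrite /lform (bigD1 ord0) //= big1 => [|i i0]; last by rewrite /e0 (negPf i0) scale0r.
by rewrite /e0 eqxx scale1r addr0.
Qed.

Lemma x_prime : mprime x.
Proof. by rewrite -lform_e0; apply: (@lform_prime _ _ _ ord0); rewrite /e0 eqxx oner_eq0. Qed.

Lemma lform_split (c : 'I_n.+1 -> K) :
  lform c = (c ord0)%:MP * x + mlift (lform (fun i => c (lift ord0 i))).
Proof.
rewrite {1}/lform big_ord_recl mul_mpolyC; congr (_ + _).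
rewrite /lform rmorph_sum; apply: eq_bigr => i _.
by rewrite -!mul_mpolyC rmorphM /= mliftC mliftX.
Qed.

Lemma mred_lform (c : 'I_n.+1 -> K) : mred (lform c) = lform (fun i => c (lift ord0 i)).
Proof. by rewrite lform_split rmorphD rmorphM /= mredX0 mulr0 add0r mliftK. Qed.

(* Numerators for the arrangement, its deletion and its restriction. *)
Definition numD := numer (fun L => L \in ls) a p.
Definition numA (t : pform K n.+1) : Prop :=
  numD t /\ forall I, mdvd x (wed (cst e0) t I).
Definition numR := numer (fun X => X \in xs) b (p - 1).

(** For t = t_0 /\ dx_1 + t_1 with t_1 divisible by x, the residue of t / (x Q') is t_0 / Q' mod x;
    this is its numerator. *)
Definition rho (t : pform K n.+1) : pform K n := [ffun J => mred (part0 t J)].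

Lemma part0P c (u v : pform K n.+1) J : part0 (c *: u + v) J = c * part0 u J + part0 v J.
Proof. by rewrite /part0 pformP mulrDr mulrCA. Qed.

Lemma rhoP c u v : rho (c *: u + v) = mred c *: rho u + rho v.
Proof.
by apply/ffunP => J; rewrite pformP !ffunE part0P rmorphD rmorphM.
Qed.

Lemma rho_semilinear : semilinear_on (@mred K n) numA rho.
Proof. by move=> c u v _ _; apply: rhoP. Qed.

Lemma rhoZ c u : rho (c *: u) = mred c *: rho u.
Proof.
by apply/ffunP => J; rewrite ffunZE !ffunE /part0 ffunZE mulrCA rmorphM.
Qed.

Lemma sgnK (R : comNzRingType) k (y : R) : (-1) ^+ k * ((-1) ^+ k * y) = y.
Proof. by rewrite mulrA -exprD addnn -mul2n exprM sqrrN !expr1n mul1r. Qed.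

Lemma wed_e0_zset (t : {set 'I_n.+1} -> S) (J : {set 'I_n}) :
  (-1) ^+ #|J| * wed (cst e0) t (zset J) = part1 t J.
Proof.
rewrite wed_zset /cst /e0 eqxx mpolyC1 mul1r.
rewrite (eq_wed (b := fun i => 0 * 0) _ _ (fun=> erefl)) ?wedZl ?mul0r ?subr0 //.
Qed.

Lemma wed_e0_lset (t : {set 'I_n.+1} -> S) (J : {set 'I_n}) : wed (cst e0) t (lset J) = 0.
Proof.
rewrite wed_lset (eq_wed (b := fun i => 0 * 0) _ _ (fun=> erefl)) ?wedZl ?mul0r //.
Qed.

Lemma wed_e0_dvd (t : {set 'I_n.+1} -> S) :
  (forall I, mdvd x (wed (cst e0) t I)) <-> forall J, mdvd x (part1 t J).
Proof.
split=> h.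
  by move=> J; rewrite -wed_e0_zset; apply: mdvdMl.
move=> I; have [J ->] := set_ord0P I; case: ifP => _; last first.
  by rewrite wed_e0_lset; apply: mdvd0.
by rewrite -[wed _ _ _](sgnK #|J|) wed_e0_zset; apply: mdvdMl.
Qed.

Lemma numA_submod : submod numA.
Proof.
have hD := numer_submod (fun L => L \in ls) a p.
split.
  split; [by case: hD|apply/wed_e0_dvd => J].
  by rewrite /part1 ffunE; apply: mdvd0.
move=> c u v [Du /wed_e0_dvd hu] [Dv /wed_e0_dvd hv]; split; first exact: hD.2.
apply/wed_e0_dvd => J; rewrite /part1 pformP.
by apply: mdvdD; [apply: mdvdMl; apply: hu|apply: hv].
Qed.

(** The inclusion of Omega(A') in Omega(A): t / Q' has the numerator x t over x Q'. *)
Lemma numA_x t : numD t -> numA (x *: t).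
Proof.
move=> Dt; split; first by apply: submodZ => //; apply: numer_submod.
by apply/wed_e0_dvd => J; rewrite /part1 ffunZE; apply/mdvdMr/mdvd_refl.
Qed.

(** When the residue vanishes, x divides t_0 as well as t_1. The quotient of t by x stays
    logarithmic along L because alpha_L is prime and does not divide x. *)
Lemma rho_ker t : numA t /\ rho t = 0 <-> exists2 t', numD t' & t = x *: t'.
Proof.
split=> [[[[dt ht] /wed_e0_dvd h1] r0]|[t' Dt ->]]; last first.
  by split; [apply: numA_x|rewrite rhoZ mredX0 scale0r].
have h0 J : mdvd x (part0 t J).
  by apply/mdvdx; have := congr1 (fun f : pform K n => f J) r0; rewrite !ffunE.
have [t' ht'] : exists t' : {set 'I_n.+1} -> S, forall I, t I = x * t' I.
  apply: (choice (fun I f => t I = x * f)) => I.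
  have [J ->] := set_ord0P I; case: ifP => _; last exact: h1.
  by rewrite -[t (zset J)](sgnK #|J|) -/(part0 t J); apply: mdvdMl.
have x0 : x != 0 by case: x_prime.
exists [ffun I => t' I]; last by apply/ffunP => I; rewrite ffunZE ffunE.
split=> [I hI|L Lls I].
  by rewrite ffunE; apply: (mulfI x0); rewrite -ht' dt // mulr0.
have [_ _ pL] := a_prime Lls.
case: (pL x (wed (cst (a L)) [ffun I => t' I] I)) => //.
  have := ht L Lls I; rewrite -wedZ; congr (mdvd _ _).
  by apply: eq_wed => // J; rewrite ffunE.
by move/(a_ndvdx Lls).
Qed.

(** In the dx_1-part of t /\ d alpha_L the term with t_1 vanishes mod x. Up to sign there remains
    the wedge of the residue with the reduction of d alpha_L, and alpha_L reduces to a nonzero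
    multiple of beta_X. *)
Lemma rho_numR t : numA t -> numR (rho t).
Proof.
move=> [[dt ht] /wed_e0_dvd h1]; split=> [J hJ|X /xsP[L Lls ->] J].
  rewrite ffunE /part0 dt ?mulr0 ?rmorph0 //; rewrite card_zset.
  by apply: contra hJ => /eqP <-; rewrite -addn1 PoszD addrK.
have [c c0 ab] := a_b Lls.
have E : c%:MP * wed (cst (b (rst L))) (rho t) J =
    mred ((a L ord0)%:MP * part1 t J - (-1) ^+ #|J| * wed (cst (a L)) t (zset J)).
  rewrite wed_zset opprB addrC subrK rmorph_wed -wedZl.
  apply: eq_wed => [i|L']; last by rewrite ffunE.
  by rewrite /cst /= mredC ab mpolyCM.
have [f hf] := ht L Lls (zset J).
have h1J : mred (part1 t J) = 0 by apply/mdvdx.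
move: E; rewrite rmorphB !rmorphM /= h1J mulr0 sub0r hf rmorphM /= mred_lform.
have -> : lform (fun i => a L (lift ord0 i)) = c%:MP * lform (b (rst L)).
  rewrite /lform mulr_sumr; apply: eq_bigr => i _.
  by rewrite ab mul_mpolyC scalerA.
move=> E; exists (- (mred ((-1) ^+ #|J|) * mred f)).
have cM : c%:MP_[n] != 0 by rewrite mpolyC_eq0.
by apply: (mulfI cM); rewrite E; ring.
Qed.

Definition unset (I : {set 'I_n.+1}) : {set 'I_n} := [set j | lift ord0 j \in I].

Lemma unset_lset J : unset (lset J) = J.
Proof. by apply/setP => j; rewrite inE mem_lset. Qed.
Lemma unset_zset J : unset (zset J) = J.
Proof. by apply/setP => j; rewrite inE mem_zset. Qed.

Definition join (t0 t1 : {set 'I_n} -> S) : pform K n.+1 :=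
  [ffun I : {set 'I_n.+1} => if ord0 \in I then (-1) ^+ #|unset I| * t0 (unset I)
             else t1 (unset I)].

Lemma join_part0 t0 t1 J : part0 (join t0 t1) J = t0 J.
Proof. by rewrite /part0 ffunE setU11 unset_zset sgnK. Qed.

Lemma join_part1 t0 t1 J : part1 (join t0 t1) J = t1 J.
Proof. by rewrite /part1 ffunE (negPf (lset0 _)) unset_lset. Qed.

Lemma join_deg t0 t1 : (forall J : {set 'I_n}, #|J|%:Z != p - 1 -> t0 J = 0) ->
  (forall J : {set 'I_n}, #|J|%:Z != p -> t1 J = 0) ->
  forall I : {set 'I_n.+1}, #|I|%:Z != p -> join t0 t1 I = 0.
Proof.
move=> h0 h1 I; have [J ->] := set_ord0P I; rewrite ffunE.
case: ifP => _; last by rewrite card_lset (negPf (lset0 _)) unset_lset; apply: h1.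
rewrite card_zset setU11 unset_zset => hJ; rewrite h0 ?mulr0 //.
by apply: contra hJ => /eqP E; rewrite -addn1 PoszD E subrK.
Qed.

(** Multiplication by all the forms makes any numerator logarithmic along A', and t_1 = 0 settles
    the condition along H. The descent starts here. *)
Lemma lift_all z : numR z ->
  exists2 t, numA t & rho t = mred (\prod_(L <- ls) lform (a L)) *: z.
Proof.
move=> [dz hz]; set Q := \prod_(L <- ls) _.
pose t := join (fun J => mlift (z J)) (fun _ => 0).
exists (Q *: t); last first.
  rewrite rhoZ; congr (_ *: _); apply/ffunP => J.
  by rewrite ffunE join_part0 mliftK.
split; [split|].
- move=> I hI; rewrite ffunZE join_deg ?mulr0 // => J hJ.
  by rewrite dz // rmorph0.
- move=> L Lls I; rewrite wed_pformZ; apply: mdvdMr.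
  by rewrite /Q (big_rem L) //=; apply/mdvdMr/mdvd_refl.
- apply/wed_e0_dvd => J; rewrite /part1 ffunZE -/(part1 t J) join_part1 mulr0.
  exact: mdvd0.
Qed.

(* For z /\ d beta = beta kappa, the numerator z /\ dx_1 - x_1 kappa is
   logarithmic along every hyperplane meeting H in X. *)
Lemma lift_local X z : X \in xs -> numR z ->
  exists2 t, numA t &
    rho t = mred (\prod_(L <- ls | rst L != X) lform (a L)) *: z.
Proof.
move=> Xxs [dz hz]; set G := \prod_(L <- ls | _) _.
have [k hk] : exists k : {set 'I_n} -> Sb,
    forall J, wed (cst (b X)) z J = lform (b X) * k J.
  exact: (choice (fun J f => wed (cst (b X)) z J = lform (b X) * f) (hz X Xxs)).
have b0 : lform (b X) != 0.
  have /xsP[L Lls XL] := Xxs; have [c c0 ab] := a_b Lls.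
  have [f0 _ _] := abar_prime Lls; apply: contra f0 => /eqP b0.
  rewrite mred_lform /lform big1 // => i _; rewrite ab -XL.
  by have := lform_coef (b X) i; rewrite b0 mcoeff0 => <-; rewrite mulr0 scale0r.
have dk (J : {set 'I_n}) : #|J|%:Z != p -> k J = 0.
  move=> hJ; apply: (mulfI b0); rewrite -hk mulr0; apply: (wed_deg _ dz).
  by rewrite subrK.
(* beta kappa /\ d beta = z /\ d beta /\ d beta = 0; this settles the components without dx_1. *)
have wk J : wed (cst (b X)) k J = 0.
  apply: (mulfI b0); rewrite -wedZ mulr0 -[RHS](wed_wed (cst (b X)) z J).
  by apply: eq_wed => // I; rewrite hk.
pose t := join (fun J => mlift (z J)) (fun J => - x * mlift (k J)).
exists (G *: t); last first.
  rewrite rhoZ; congr (_ *: _); apply/ffunP => J.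
  by rewrite ffunE join_part0 mliftK.
split; [split|].
- move=> I hI; rewrite ffunZE join_deg ?mulr0 // => J hJ.
    by rewrite dz // rmorph0.
  by rewrite dk // rmorph0 mulr0.
- move=> L Lls I; rewrite wed_pformZ.
  have [LX|nX] := eqVneq (rst L) X; last first.
    by apply: mdvdMr; rewrite /G (big_rem L) //= nX; apply/mdvdMr/mdvd_refl.
  apply: mdvdMl; have [c c0 ab] := a_b Lls; rewrite LX in ab.
  have wE (s : {set 'I_n} -> S) (s' : {set 'I_n} -> Sb) d J :
      (forall I, s I = d * mlift (s' I)) ->
      wed (fun i => cst (a L) (lift ord0 i)) s J =
      c%:MP * d * mlift (wed (cst (b X)) s' J).
    move=> hs; rewrite rmorph_wed -mulrA -wedZ -wedZl.
    apply: eq_wed => [i|J']; last by rewrite hs.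
    by rewrite /cst /= mliftC ab mpolyCM.
  have [J ->] := set_ord0P I; case: ifP => _; last first.
    rewrite wed_lset (wE _ k (- x)) => [|J']; last by rewrite join_part1.
    by rewrite wk rmorph0 mulr0; apply: mdvd0.
  rewrite -[wed _ _ _](sgnK #|J|) wed_zset; apply: mdvdMl.
  rewrite (wE _ z 1) => [|J']; last by rewrite join_part0 mul1r.
  rewrite hk join_part1 rmorphM /= lform_split.
  have -> : lform (fun i => a L (lift ord0 i)) = c%:MP * lform (b X).
    rewrite /lform mulr_sumr; apply: eq_bigr => i _.
    by rewrite ab mul_mpolyC scalerA.
  (* Since alpha_L = a_0 x + c beta, the dx_1-component is a_0 (- x kappa) - c beta kappa = -
     alpha_L kappa. *)
  exists (- mlift (k J)); rewrite rmorphM /= mliftC /cst.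
  ring.
- apply/wed_e0_dvd => J; rewrite /part1 ffunZE -/(part1 t J) join_part1.
  by apply: mdvdMl; rewrite mulNr; apply/mdvdN/mdvdMr/mdvd_refl.
Qed.

Hypothesis numD_free : free_submod numD.

Lemma descent (F G : S) z u v :
  mcoprime F G -> mcoprime (mred F) (mred G) ->
  (forall L, L \in ls -> ~ mdvd (lform (a L)) F \/ ~ mdvd (lform (a L)) G) ->
  ~ mdvd x F -> ~ mdvd x G ->
  numA u -> numA v -> rho u = mred F *: z -> rho v = mred G *: z ->
  exists2 w, numA w & rho w = z.
Proof.
move=> cop copr FG xF xG Au Av ru rv.
have hA := numA_submod.
have F0r : mred F != 0 by apply/eqP => /mdvdx.
have G0r : mred G != 0 by apply/eqP => /mdvdx.
have F0 : F != 0 by apply: contra F0r => /eqP ->; rewrite rmorph0.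
have G0 : G != 0 by apply: contra G0r => /eqP ->; rewrite rmorph0.
have E1 : G *: u - F *: v = G *: u + (- F) *: v by rewrite scaleNr.
(* Over the denominator x Q' the element G u - F v of Omega(A') has a numerator x m with m in
   [numD]. As u and v also lie in [numD], this is a relation inside a free module. *)
have [|m Dm xm] := (rho_ker (G *: u - F *: v)).1.
  split; first by apply: submodB => //; apply: submodZ.
  rewrite E1 rhoP rhoZ ru rv rmorphN /= !scalerA mulNr mulrC scaleNr subrr //.
have x_reg (f : S) : x * f = 0 -> f = 0.
  have [x0 _ _] := x_prime.
  by move=> /eqP; rewrite mulf_eq0 (negPf x0) => /eqP.
have [m1 [m2 [D1 D2 mE]]] := free_regular_sequence (@mliftK K n) (@mred_eq0P K n) x_reg
  numD_free (numer_fin_gen _ _ _) copr (mulfI G0r) Au.1 Av.1 Dm (esym xm).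
(* Subtracting elements of x [numD] leaves the residues unchanged and turns the relation into F v' =
   G u'. *)
pose u' := u - x *: m1; pose v' := v - x *: m2.
have uE I : u' I = u I - x * m1 I by rewrite pformB [X in _ - X]ffunZE.
have vE I : v' I = v I - x * m2 I by rewrite pformB [X in _ - X]ffunZE.
have A1 : numA u' by apply: submodB => //; apply: numA_x.
have A2 : numA v' by apply: submodB => //; apply: numA_x.
have uv I : F * v' I = G * u' I.
  have := congr1 (fun f : pform K n.+1 => f I) xm.
  rewrite [LHS]pformBZ mE [RHS]ffunZE [X in _ = _ * X -> _]pformBZ.
  by move/regular_relation; rewrite uE vE.
have [w hw] : exists w : {set 'I_n.+1} -> S, forall I, v' I = G * w I.
  by apply: (choice (fun I f => v' I = G * f)) => I; apply: cop (uv I).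
have hw' I : u' I = F * w I.
  by apply: (mulfI G0); rewrite -uv hw mulrCA.
pose wf : pform K n.+1 := [ffun I => w I].
have uw : u' = F *: wf by apply/ffunP => I; rewrite [RHS]ffunZE [X in _ = _ * X]ffunE; apply: hw'.
have vw : v' = G *: wf by apply/ffunP => I; rewrite [RHS]ffunZE [X in _ = _ * X]ffunE; apply: hw.
exists wf; last first.
  have : mred F *: rho wf = mred F *: z.
    rewrite -rhoZ -uw -ru /u' -scaleNr addrC rhoP ?rmorphN /= mredX0 oppr0 scale0r.
    by rewrite add0r.
  move=> Ez; apply/ffunP => J; apply: (mulfI F0r).
  by have := congr1 (fun f : pform K n => f J) Ez; rewrite !ffunZE.
split; [split|].
- move=> I hI; rewrite ffunE; apply: (mulfI F0).
  by rewrite -hw' mulr0; apply: A1.1.1.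
(* Along L, the multiple of w by whichever of F and G is not divisible by alpha_L gives the
   condition. *)
- move=> L Lls I; have [_ _ pL] := a_prime Lls.
  have := A1.1.2 L Lls I; rewrite uw wed_pformZ => /pL d1.
  have := A2.1.2 L Lls I; rewrite vw wed_pformZ => /pL d2.
  by case: (FG L Lls) => nd; [case: d1|case: d2].
- move=> I; have [_ _ px] := x_prime.
  by have := A1.2 I; rewrite uw wed_pformZ => /px[].
Qed.

(** [P V] is the claim up to the factor [Q V] of the forms above V. To remove X, [descent] is
    applied to Q V y: the factor F Q V is the one already reached, G Q V is that of [lift_local]. F
    and G are coprime, also after reduction, because their factors lie over different elements of
    A^H. *)
Lemma rho_surjective z : numR z -> exists2 t, numA t & rho t = z.
Proof.
pose Q (V : seq T') := \prod_(L <- ls | rst L \in V) lform (a L).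
pose P (V : seq T') := forall z, numR z ->
  exists2 t, numA t & rho t = mred (Q V) *: z.
suff hP V : uniq V -> {subset V <= xs} -> P V -> P [::].
  move=> Rz; have P0 : P [::].
    apply: (hP xs) => // y Ry.
    have [t At rt] := lift_all Ry; exists t; [exact: At|rewrite {}rt /Q].
    congr (mred _ *: _); rewrite big_seq [RHS]big_seq_cond.
    apply: eq_bigl => L; case: (boolP (L \in ls)) => //= Lls.
    by symmetry; apply/xsP; exists L.
  have [t At] := P0 z Rz.
  by rewrite /Q big_pred0 // rmorph1 scale1r; exists t.
elim: V => [|X V IH]; first by move=> _ _; apply.
rewrite cons_uniq => /andP[XV uV] sV PXV; apply: (IH uV) => [y yV|].
  by apply: sV; rewrite inE yV orbT.
move=> y Ry; have Xxs : X \in xs by apply: sV; rewrite mem_head.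
pose F := \prod_(L <- ls | rst L == X) lform (a L).
pose G := \prod_(L <- ls | (rst L != X) && (rst L \notin V)) lform (a L).
have QF : Q (X :: V) = F * Q V.
  rewrite /Q (bigID (fun L => rst L == X)) /=; congr (_ * _); apply: eq_bigl => L.
    by rewrite inE; case: (rst L == X); rewrite ?andbF.
  by rewrite inE; case: eqP => [->|_]; rewrite ?andbT ?andbF ?(negPf XV).
have QG : \prod_(L <- ls | rst L != X) lform (a L) = G * Q V.
  rewrite (bigID (fun L => rst L \in V)) /= mulrC; congr (_ * _).
  by apply: eq_bigl => L; case: eqP => [->|]; rewrite //= (negPf XV).
have [u Au ru] := PXV y Ry.
have [v Av rv] := lift_local Xxs Ry.
have ndF L : L \in ls -> rst L != X -> ~ mdvd (lform (a L)) F.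
  move=> Lls LX; rewrite /F big_seq_cond; apply: mprime_prod.
    exact: a_prime.
  move=> L' /andP[L'ls /eqP L'X]; apply: a_ndvd => //.
  by apply: contra LX => /eqP ->; rewrite L'X.
have ndG L : L \in ls -> rst L == X -> ~ mdvd (lform (a L)) G.
  move=> Lls LX; rewrite /G big_seq_cond; apply: mprime_prod.
    exact: a_prime.
  move=> L' /and3P[L'ls L'X _]; apply: a_ndvd => //.
  by apply: contra L'X => /eqP <-.
apply: (descent (F := F) (G := G)) Au Av _ _.
- rewrite /F big_seq_cond; apply: mcoprime_prod => L _ /andP[Lls LX].
  by split; [apply: a_prime|apply: ndG].
- rewrite /F /G big_seq_cond !rmorph_prod; apply: mcoprime_prod => L _ /andP[Lls LX].
  split; first exact: abar_prime.
  rewrite big_seq_cond; apply: mprime_prod; first exact: abar_prime.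
  move=> L' /and3P[L'ls L'X _]; apply: abar_ndvd => //.
  by apply: contra L'X => /eqP <-.
- move=> L Lls; have [LX|LX] := boolP (rst L == X); [right|left].
    exact: ndG.
  exact: ndF.
- rewrite /F big_seq_cond; apply: mprime_prod; first exact: x_prime.
  by move=> L /andP[Lls _]; apply: x_ndvda.
- rewrite /G big_seq_cond; apply: mprime_prod; first exact: x_prime.
  by move=> L /andP[Lls _]; apply: x_ndvda.
- by rewrite ru QF mredM -scalerA.
- by rewrite rv QG mredM -scalerA.
Qed.

End PolynomialResidue.

(** * Lifting a minimal family of generators *)

Section MinimalLift.
Variables (R Rb : comNzRingType) (red : {rmorphism R -> Rb}).
Variables (lft : {rmorphism Rb -> R}).
Hypothesis lftK : cancel lft red.
Variables (V : lmodType R) (Vb : lmodType Rb) (M M' : V -> Prop).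
Variables (N : Vb -> Prop) (r : V -> Vb).
Hypothesis hM : submod M.
Hypothesis rP : semilinear_on red M r.
Hypothesis rN : forall y, N y <-> exists2 u, M u & r u = y.
Hypothesis rK : forall u, M' u <-> M u /\ r u = 0.

(** The least number of generators gives both senses of minimality, since a generating proper
    subfamily would be smaller. An element minus a suitable combination of the lifts has image 0, so
    lies in M'. *)
Lemma minimal_lift : fin_gen N ->
  exists s (w : 'I_s -> V),
    [/\ forall i, M (w i), minimal_generators N (fun i => r (w i))
      & forall w', M w' <-> exists2 u, M' u &
          exists c : 'I_s -> R, w' = u + \sum_i c i *: w i].
Proof.
move=> [s0 hs0]; have [s [[g gN] smin]] : exists s,
    (exists g : 'I_s -> Vb, generates N g) /\
    forall t (h : 'I_t -> Vb), generates N h -> (s <= t)%N.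
  elim/ltn_ind: s0 hs0 => s IH hs.
  have [[t ts ht]|h] :=
      classic (exists2 t, (t < s)%N & exists h : 'I_t -> Vb, generates N h).
    exact: IH ht.
  exists s; split=> // t f hf; rewrite leqNgt; apply/negP => ts.
  by apply: h; exists t => //; exists f.
have [w hw] : exists w : 'I_s -> V, forall i, M (w i) /\ r (w i) = g i.
  apply: (choice (fun i u => M u /\ r u = g i)) => i.
  by have [u Mu ru] := (rN (g i)).1 (generates_gen i gN); exists u.
have Mw i : M (w i) by case: (hw i).
have wE : (fun i => r (w i)) = g.
  by apply: functional_extensionality => i; case: (hw i).
have r0 : r 0 = 0.
  have := rP (-1) hM.1 hM.1.
  by rewrite scaler0 addr0 rmorphN1 scaleN1r addNr.
have Msum (c : 'I_s -> R) : M (\sum_i c i *: w i) /\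
    r (\sum_i c i *: w i) = \sum_i red (c i) *: g i.
  elim/big_ind2: _ => [|z1 y1 z2 y2 [M1 <-] [M2 <-]|i _].
  - by split=> //; case: hM.
  - split; first exact: submodD.
    by rewrite -[y1]scale1r rP // rmorph1 !scale1r.
  - split; first exact: submodZ.
    rewrite -[c i *: w i]addr0 rP //; last by case: hM.
    by rewrite (hw i).2 r0 addr0.
exists s, w; split=> //.
  rewrite wE; split=> // J /properP[_ [k _ kJ]] span.
  have JS : (#|J| < s)%N.
    rewrite -[X in (_ < X)%N]card_ord -cardsT; apply: proper_card.
    by apply/properP; split; [apply: subsetT|exists k].
  have /smin : generates N (fun i : 'I_#|J| => g (enum_val i)).
    move=> y; split=> [/span[c ->]|[c ->]].
      exists (fun i => c (enum_val i)).
      by rewrite (big_enum_val (A := mem J) (fun i => c i *: g i)).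
    have hN : submod N.
      have hI := submod_image (comb g); move/generatesP: (gN) => gN'.
      by split=> [|a u v /gN' hu /gN' hv]; apply/gN'; [case: hI|apply: hI.2].
    by apply: submod_sum => // i _; apply: submodZ => //; apply: generates_gen gN.
  by rewrite leqNgt JS.
move=> w'; split=> [Mw'|[u /rK[Mu _] [c ->]]]; last first.
  by apply: submodD => //; case: (Msum c).
have [|c rw] := (gN (r w')).1; first by apply/rN; exists w'.
have [Mc rc] := Msum (fun i => lft (c i)).
exists (w' - \sum_i lft (c i) *: w i); last first.
  by exists (fun i => lft (c i)); rewrite subrK.
apply/rK; split; first exact: submodB.
rewrite -scaleN1r addrC rP // rc rmorphN1 scaleN1r rw addrC.
by rewrite -sumrB big1 // => i _; rewrite lftK subrr.
Qed.

End MinimalLift.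

Lemma free_fin_preimage (R : comNzRingType) (W W' : lmodType R)
    (f : {linear W -> W'}) (M : W -> Prop) q (j : {linear 'rV[R]_q -> W'}) :
  submod M -> (forall u, M u -> f u = 0 -> u = 0) ->
  (forall u, j u = 0 -> u = 0) ->
  (forall w, (exists2 u, M u & f u = w) <-> exists u, j u = w) ->
  exists i : {linear 'rV[R]_q -> W},
    (forall u, i u = 0 -> u = 0) /\ forall w, M w <-> exists u, i u = w.
Proof.
move=> hM inj jinj jM.
have [s hs] : exists s : 'rV[R]_q -> W, forall u, M (s u) /\ f (s u) = j u.
  apply: (choice (fun u w => M w /\ f w = j u)) => u.
  by have [|w Mw fw] := (jM (j u)).2; [exists u|exists w].
have injM u v : M u -> M v -> f u = f v -> u = v.
  move=> Mu Mv fuv; apply/subr0_eq/inj; first exact: submodB.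
  by rewrite linearB fuv subrr.
have l : linear s.
  move=> a u v; apply: injM; rewrite ?linearP ?(hs _).2 ?linearP //.
    exact: (hs _).1.
  by apply: hM.2; apply: (hs _).1.
exists (mklin l); split=> [u|w].
  by rewrite mklinE => su; apply: jinj; rewrite -(hs u).2 su linear0.
split=> [Mw|[u <-]]; last exact: (hs _).1.
have [|u hu] := (jM (f w)).1; first by exists w.
by exists u; apply: injM; rewrite ?mklinE ?(hs _).2 //; apply: (hs _).1.
Qed.

Lemma free_submod_eq (R : comNzRingType) (W : lmodType R) (M M' : W -> Prop) :
  (forall w, M w <-> M' w) -> free_submod M -> free_submod M'.
Proof.
move=> MM' [B [B1 B2 B3]]; exists B; split=> // [v /B1/MM' //|w /MM'].
exact: B2.
Qed.

Lemma free_submod_preimage (R : comNzRingType) (W W' : lmodType R)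
    (f : {linear W -> W'}) (M : W -> Prop) :
  submod M -> (forall u, f u = 0 -> u = 0) -> fin_gen M ->
  free_submod (fun w => exists2 u, M u & f u = w) -> free_submod M.
Proof.
move=> hM inj fgM fF.
have [q [j [jinj jM]]] := free_fin_basis fF (fin_gen_image f fgM).
have [i [iinj iM]] := free_fin_preimage hM (fun u _ => inj u) jinj jM.
exact: injective_free_submod iinj iM.
Qed.

Lemma free_submod_image (R : comNzRingType) (W W' : lmodType R)
    (f : {linear W -> W'}) (M : W -> Prop) :
  (forall u, f u = 0 -> u = 0) -> fin_gen M -> free_submod M ->
  free_submod (fun w => exists2 u, M u & f u = w).
Proof.
move=> inj fgM /free_fin_basis/(_ fgM)[q [j [jinj jM]]].
have l : linear (fun u => f (j u)) by move=> a u v; rewrite !linearP.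
apply: (injective_free_submod (j := mklin l)) => [u /inj/jinj //|w].
split=> [[u /jM[v <-] <-]|[u <-]]; first by exists v.
by exists (j u) => //; apply/jM; exists u.
Qed.

Lemma free_pd_le (R : comNzRingType) (W : lmodType R) (M : W -> Prop) :
  fin_gen M -> free_submod M -> pd_le M 0.
Proof.
move=> fgM /free_fin_basis/(_ fgM)[q [j [jinj jM]]].
by apply/pd_le0; exists 'rV[R]_q, j; split=> //; apply: projective_rV.
Qed.

(** * Rational forms as quotients of numerators *)

Section Fractions.
Variables (K : fieldType) (m : nat).
Local Notation S := {mpoly K[m]}.
Local Notation tf := (@FracField.tofrac S).

Definition pfrac (c : S) (t : pform K m) : rform K m := [ffun I => tf (t I) / tf c].

Lemma rformP (c : S) (u v : rform K m) I : (c *: u + v) I = tf c * u I + v I.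
Proof. by rewrite !ffunE. Qed.

Lemma rformZ (c : S) (u : rform K m) I : (c *: u) I = tf c * u I.
Proof. by rewrite ffunE. Qed.

Fact pfrac_linear c : linear (pfrac c).
Proof.
move=> d u v; apply/ffunP => I; rewrite rformP [LHS]ffunE pformP.
rewrite [X in _ = _ * X + _]ffunE [X in _ = _ + X]ffunE.
by rewrite tofracD tofracM mulrDl mulrA.
Qed.

Definition pfrac_map c := @mklin S (pform K m) (rform K m) _ (pfrac_linear c).

Lemma pfrac_mapE c t : pfrac_map c t = pfrac c t.
Proof. by []. Qed.

Lemma pfrac_map_inj c t : c != 0 -> pfrac_map c t = 0 -> t = 0.
Proof.
rewrite pfrac_mapE => c0 t0; apply/ffunP => I; rewrite ffunE; apply/eqP.
have /eqP := congr1 (fun f : rform K m => f I) t0; rewrite !ffunE.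
by rewrite mulf_eq0 invr_eq0 !tofrac_eq0 (negPf c0) orbF.
Qed.

Lemma pfracM c d t : c != 0 -> pfrac (c * d) (c *: t) = pfrac d t.
Proof.
move=> c0; apply/ffunP => I; rewrite [LHS]ffunE ffunZE [RHS]ffunE !tofracM.
by rewrite -mulf_div divff ?mul1r // tofrac_eq0.
Qed.

(** Only J = I minus i contributes, and the pairs counted by [wedge_sign] are then the (k, i) with i
    < k. *)
Lemma wedge_fdx (u : rform K m) f i I :
  wedge u (fdx f i) I =
  if i \in I then (-1) ^+ #|[set j in I | (i < j)%N]| * f * u (I :\ i) else 0.
Proof.
rewrite ffunE; case: ifP => iI; last first.
  rewrite big1 // => J JI; rewrite ffunE ifN ?mulr0 //.
  apply/eqP => E; have : i \in I :\: J by rewrite E set11.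
  by rewrite inE iI andbF.
have IJ (J : {set 'I_m}) : J \subset I -> (I :\: J == [set i]) = (J == I :\ i).
  move=> JI; apply/eqP/eqP => [E|->]; last first.
    by rewrite setDDr setDv set0U; apply/setIidPr; rewrite sub1set.
  by rewrite -E setDDr setDv set0U; symmetry; apply/setIidPr.
rewrite (bigD1 (I :\ i)) ?subsetDl //= big1 ?addr0 => [|J /andP[JI nJ]]; last first.
  by rewrite ffunE IJ // (negPf nJ) mulr0.
have E := IJ _ (subsetDl I [set i]); rewrite eqxx in E.
rewrite ffunE E (eqP E) mulrAC; congr (_ ^+ _ * _ * _).
have -> : [set ij in setX (I :\ i) [set i] | (ij.2 < ij.1)%N] =
    [set (k, i) | k in [set k in I | (i < k)%N]].
  apply/setP => -[k l]; rewrite !inE /=; apply/idP/imsetP.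
    by move=> /andP[/andP[/andP[ki kI] /eqP ->] lk]; exists k; rewrite // inE kI.
  move=> [k']; rewrite inE => /andP[kI ik] [-> ->].
  by rewrite kI ik eqxx !andbT; apply: contraTneq ik => ->; rewrite ltnn.
by rewrite card_imset // => k k' [].
Qed.

Lemma wedge_dpoly (t : pform K m) (f : S) I : f \is 1.-homog ->
  wedge [ffun I => tf (t I)] (dpoly f) I = tf (wed (cst (fun i => f@_U_(i))) t I).
Proof.
move=> hf.
have -> : wedge [ffun I => tf (t I)] (dpoly f) I =
    \sum_(i < m) wedge [ffun I => tf (t I)] (fdx (tf f^`M(i)) i) I.
  rewrite ffunE; under [RHS]eq_bigr do rewrite ffunE.
  rewrite exchange_big /=; apply: eq_bigr => J _.
  by rewrite /dpoly sum_ffunE mulr_sumr.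
rewrite /wed rmorph_sum [RHS]big_mkcond /=; apply: eq_bigr => i _.
rewrite wedge_fdx; case: ifP => // _; rewrite ffunE !rmorphM rmorphXn rmorphN1 /=.
congr (_ * tf _ * _); rewrite {1}(homog1_lform hf) /lform linear_sum /=.
rewrite (bigD1 i) //= big1 => [|j ji].
  rewrite mderivZ mderivX mnm1E eqxx scale1r.
  have -> : (U_(i) - U_(i) = 0 :> 'X_{1..m})%MM by rewrite -{1}[U_(i)%MM]add0m addmK.
  by rewrite mpolyX0 addr0 -mul_mpolyC mulr1.
by rewrite mderivZ mderivX mnm1E (negPf ji) scale0r scaler0.
Qed.

Lemma OmegaP (T : choiceType) (A : {fset T}) (alpha : T -> S) (p : int) w :
  (forall L, L \in A -> alpha L \is 1.-homog) ->
  (forall L, L \in A -> alpha L != 0) ->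
  Omega A alpha p w <->
  exists2 t, numer (fun L => L \in A) (fun L i => (alpha L)@_U_(i)) p t &
    pfrac_map (Qpoly A alpha) t = w.
Proof.
move=> hom nz.
have Q0 : Qpoly A alpha != 0.
  rewrite /Qpoly big_seq; elim/big_ind: _ => [|f g|L AL].
  - exact: oner_neq0.
  - exact: mulf_neq0.
  - exact: nz.
have tf_inj : injective tf by move=> f g /eqP; rewrite tofrac_eq => /eqP.
split=> [[[dw rw] lw]|[t [dt ht]]]; last rewrite pfrac_mapE => <-.
  have [t0 ht0] := choice (fun I f => (Qpoly A alpha *: w) I = tf f) rw.
  pose t : pform K m := [ffun I => t0 I].
  have QwE : Qpoly A alpha *: w = [ffun I => tf (t I)].
    by apply/ffunP => I; rewrite ht0 !ffunE.
  exists t; last first.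
    rewrite pfrac_mapE; apply/ffunP => I; have := ht0 I; rewrite rformZ !ffunE => <-.
    by rewrite mulrAC divff ?mul1r // tofrac_eq0.
  split=> [I hI|L AL I].
    by apply: tf_inj; rewrite ffunE -ht0 dw // tofrac0.
  have [eta [_ reta] E] := lw L AL; have [f hf] := reta I; exists f.
  apply: tf_inj; rewrite -(homog1_lform (hom L AL)) tofracM -hf -rformZ -E QwE.
  by rewrite wedge_dpoly ?hom.
have QwE : Qpoly A alpha *: pfrac (Qpoly A alpha) t = [ffun I => tf (t I)].
  apply/ffunP => I; rewrite rformZ !ffunE mulrCA divff ?mulr1 //.
  by rewrite tofrac_eq0.
rewrite /Omega QwE; split.
  split=> I; rewrite ffunE; last by exists (t I).
  by move=> hI; rewrite dt // tofrac0.
move=> L AL; have := ht L AL; rewrite -(homog1_lform (hom L AL)) => hL.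
have [k hk] := choice (fun I f =>
  wed (cst (fun i => (alpha L)@_U_(i))) t I = alpha L * f) hL.
(* Outside degree p + 1 the wedge vanishes; eta is put to 0 there, as [regular_form] demands. *)
exists [ffun I : {set 'I_m} => if #|I|%:Z == p + 1 then tf (k I) else 0].
  split=> I; rewrite ffunE; first by move=> /negPf ->.
  by case: ifP => _; [exists (k I)|exists 0; rewrite tofrac0].
apply/ffunP => I; rewrite wedge_dpoly ?hom // rformZ ffunE.
case: ifP => [_|/negbT hI]; first by rewrite hk tofracM.
by rewrite (wed_deg _ dt hI) tofrac0 mulr0.
Qed.

End Fractions.

(** The decomposition has w_0 = t_0 / Q and w_1 = t_1 / (x Q), where x cancels in the latter;
    uniqueness of residues identifies the value chosen by [res]. *)
Lemma res_pfrac (K : fieldType) n (Q : {mpoly K[n.+1]}) (t : pform K n.+1) :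
  ~ mdvd 'X_ord0 Q -> (forall J, mdvd 'X_ord0 (part1 t J)) ->
  res (pfrac ('X_ord0 * Q) t) = pfrac (mred Q) (rho t).
Proof.
move=> xQ h1; set x : {mpoly K[n.+1]} := 'X_ord0.
suff h : is_residue (pfrac (x * Q) t) (pfrac (mred Q) (rho t)).
  apply: (is_residue_uniq _ h); apply: (@epsilon_spec _ _ (is_residue (pfrac (x * Q) t))).
  by exists (pfrac (mred Q) (rho t)).
have x0 : x != 0 by case: (x_prime K n).
have Q0 : Q != 0 by apply/eqP => Q0; apply: xQ; rewrite Q0; apply: mdvd0.
have [t1 ht1] := choice (fun J f => part1 t J = x * f) h1.
have redQ f : reduces_to (FracField.tofrac f / FracField.tofrac Q)
    (FracField.tofrac (mred f) / FracField.tofrac (mred Q)).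
  by exists f, Q; split.
pose mk (s : {set 'I_n} -> {mpoly K[n.+1]}) : rform K n.+1 :=
  [ffun I : {set 'I_n.+1} => if ord0 \in I then 0 else
     FracField.tofrac (s (unset I)) / FracField.tofrac Q].
have mkP s : no_dx1_x1_regular (mk s).
  split=> I; rewrite ffunE; first by move=> ->.
  case: ifP => _; last by eexists; apply: redQ.
  by eexists; have := redQ 0; rewrite tofrac0 mul0r; apply.
exists (mk (part0 t)), (mk t1); split=> //.
  apply/ffunP => I; rewrite [RHS]ffunE wedge_fdx !ffunE.
  have [J ->] := set_ord0P I; case: ifP => _.
    rewrite setU11 addr0 setU1K ?lset0 // (negPf (lset0 _)) unset_lset.
    have -> : #|[set j in zset J | ((@ord0 n) < j)%N]| = #|J|.
      rewrite -[RHS]card_lset; apply: eq_card => j; rewrite inE.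
      case: (unliftP ord0 j) => [k|] ->; first by rewrite mem_zset mem_lset andbT.
      by rewrite ltnn andbF (negPf (lset0 _)).
    rewrite -[t (zset J)](sgnK #|J|) -/(part0 t J) !tofracM rmorphXn rmorphN1.
    by rewrite invfM mulrACA.
  rewrite (negPf (lset0 _)) add0r unset_lset -/(part1 t J) ht1 !tofracM.
  by rewrite -mulf_div divff ?mul1r // tofrac_eq0.
by move=> J; rewrite !ffunE -/(lset J) (negPf (lset0 _)) unset_lset; apply: redQ.
Qed.

(** * From the arrangement to its linear forms *)

Section ArrangementGeometry.
Variables (K : fieldType) (n : nat) (A : {fset {vspace 'rV[K]_n.+1}}).
Variables (H : {vspace 'rV[K]_n.+1}) (e : n.+1.-tuple 'rV[K]_n.+1).
Variables (alpha : {vspace 'rV[K]_n.+1} -> {mpoly K[n.+1]}).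
Variables (beta : {vspace 'rV[K]_n.+1} -> {mpoly K[n]}).
Hypothesis dimA : forall L, L \in A -> \dim L = n.
Hypothesis HA : H \in A.
Hypothesis e_basis : basis_of fullv e.
Hypothesis alphaP : forall L, L \in A ->
  defining_form fullv (fun v i => coord e i v) L (alpha L).
Hypothesis alphaH : alpha H = 'X_ord0.
Hypothesis betaP : forall X, X \in restriction A H ->
  defining_form H (fun v i => coord e (lift ord0 i) v) X (beta X).

Let a L i := (alpha L)@_U_(i).
Let b X i := (beta X)@_U_(i).

Lemma alpha_lform L : L \in A -> alpha L = lform (a L).
Proof. by move=> /alphaP[/homog1_lform]. Qed.

Lemma beta_lform X : X \in restriction A H -> beta X = lform (b X).
Proof. by move=> /betaP[/homog1_lform]. Qed.

Lemma in_deletion L : (L \in deletion A H) = (L != H) && (L \in A).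
Proof. by rewrite !inE. Qed.

Lemma deletion_sub L : L \in deletion A H -> L \in A.
Proof. by rewrite in_deletion => /andP[]. Qed.

Lemma restrictionP X :
  reflect (exists2 L, L \in deletion A H & X = (L :&: H)%VS) (X \in restriction A H).
Proof. exact: imfsetP. Qed.

Lemma exists_coord (c : 'I_n.+1 -> K) : exists v, forall i, coord e i v = c i.
Proof.
exists (\sum_i c i *: e`_i) => i; apply: coord_sum_free.
exact: basis_free e_basis.
Qed.

Lemma mem_hyperplane L v : L \in A ->
  (v \in L) = (\sum_i a L i * coord e i v == 0).
Proof.
move=> LA; have [_ /(_ v (memvf v)) ->] := alphaP LA.
by rewrite (alpha_lform LA) meval_lform.
Qed.

Lemma a_H i : a H i = (i == ord0)%:R.
Proof. by rewrite /a alphaH mcoeffXU eq_sym. Qed.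

Lemma mem_H v : (v \in H) = (coord e ord0 v == 0).
Proof.
rewrite (mem_hyperplane _ HA) big_ord_recl a_H eqxx mul1r big1 ?addr0 // => i _.
by rewrite a_H eq_sym (negPf (neq_lift _ _)) mul0r.
Qed.

Lemma mem_hyperplane_H L v : L \in A -> v \in H ->
  (v \in L) = (\sum_i a L (lift ord0 i) * coord e (lift ord0 i) v == 0).
Proof.
move=> LA; rewrite mem_H (mem_hyperplane _ LA) big_ord_recl => /eqP ->.
by rewrite mulr0 add0r.
Qed.

Lemma mem_restriction X v : X \in restriction A H -> v \in H ->
  (v \in X) = (\sum_i b X i * coord e (lift ord0 i) v == 0).
Proof.
move=> XA vH; have [_ /(_ v vH) ->] := betaP XA.
by rewrite (beta_lform XA) meval_lform.
Qed.

Lemma exists_coord_H (c : 'I_n -> K) :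
  exists2 v, v \in H & forall i, coord e (lift ord0 i) v = c i.
Proof.
have [v hv] := exists_coord (fun i => if unlift ord0 i is Some k then c k else 0).
exists v; first by rewrite mem_H hv unlift_none.
by move=> i; rewrite hv liftK.
Qed.

Lemma hyperplane_eq L L' : L \in A -> L' \in A -> (L <= L')%VS -> L = L'.
Proof. by move=> LA L'A LL'; apply/eqP; rewrite eqEdim LL' (dimA LA) (dimA L'A) leqnn. Qed.

Lemma a_neq0 L : L \in A -> exists i, a L i != 0.
Proof.
move=> LA; have [//|h] := classic (exists i, a L i != 0).
have aL i : a L i = 0 by apply/eqP/negPn/negP => ai; apply: h; exists i.
have Lf : L = fullv.
  apply/eqP; rewrite eqEsubv subvf; apply/subvP => v _.
  by rewrite (mem_hyperplane _ LA) big1 // => i _; rewrite aL mul0r.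
have := dimA LA; rewrite Lf dimvf dim_matrix mul1r => E.
by case: (n_Sn n).
Qed.

(** A form in x_1 alone vanishes on H, which would force L = H by dimension. *)
Lemma abar_neq0 L : L \in deletion A H -> exists i, a L (lift ord0 i) != 0.
Proof.
move=> LD; have LA := deletion_sub LD.
have [//|h] := classic (exists i, a L (lift ord0 i) != 0).
have aL i : a L (lift ord0 i) = 0 by apply/eqP/negPn/negP => ai; apply: h; exists i.
move: LD; rewrite in_deletion; case/andP => /eqP[]; symmetry.
apply: hyperplane_eq => //; apply/subvP => v vH.
by rewrite (mem_hyperplane_H LA vH) big1 // => i _; rewrite aL mul0r.
Qed.

Lemma alpha_prime L : L \in A -> mprime (lform (a L)).
Proof. by move=> /a_neq0[i]; apply: lform_prime. Qed.

Lemma alphabar_prime L : L \in deletion A H -> mprime (mred (lform (a L))).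
Proof. by move=> /abar_neq0[i ai]; rewrite mred_lform; apply: (@lform_prime _ _ _ i). Qed.

Lemma mdvd_lform m (c d : 'I_m -> K) : mdvd (lform c) (lform d) ->
  forall v : 'I_m -> K, \sum_i c i * v i = 0 -> \sum_i d i * v i = 0.
Proof. by move=> [f E] v c0; rewrite -!meval_lform E mevalM meval_lform c0 mul0r. Qed.

(** Divisibility of forms gives inclusion of hyperplanes, hence equality by dimension. *)
Lemma alpha_ndvd L L' : L \in A -> L' \in A -> L != L' ->
  ~ mdvd (lform (a L)) (lform (a L')).
Proof.
move=> LA L'A /eqP nLL' /mdvd_lform h; apply: nLL'; apply: hyperplane_eq => //.
apply/subvP => v; rewrite (mem_hyperplane _ LA) (mem_hyperplane _ L'A).
by move=> /eqP/h/eqP.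
Qed.

Lemma alphabar_ndvd L L' : L \in deletion A H -> L' \in deletion A H ->
  (L :&: H)%VS != (L' :&: H)%VS ->
  ~ mdvd (mred (lform (a L))) (mred (lform (a L'))).
Proof.
move=> LD L'D /eqP nLL'; rewrite !mred_lform => /mdvd_lform/lform_proportional[c hc].
have c0 : c != 0.
  have [i ai] := abar_neq0 L'D; apply: contra ai => /eqP c0.
  by rewrite hc c0 mul0r.
apply: nLL'; apply/vspaceP => v; rewrite !memv_cap.
have [vH|] := boolP (v \in H); rewrite ?andbF // !andbT.
rewrite (mem_hyperplane_H (deletion_sub LD) vH) (mem_hyperplane_H (deletion_sub L'D) vH).
have -> : \sum_i a L' (lift ord0 i) * coord e (lift ord0 i) v =
    c * \sum_i a L (lift ord0 i) * coord e (lift ord0 i) v.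
  by rewrite mulr_sumr; apply: eq_bigr => i _; rewrite hc mulrA.
by rewrite mulf_eq0 (negPf c0).
Qed.

(** Both forms cut out the same subspace of H, and the coordinates x_2, ..., x_l take all values on
    H. *)
Lemma alpha_beta L : L \in deletion A H ->
  exists2 c : K, c != 0 & forall i, a L (lift ord0 i) = c * b (L :&: H)%VS i.
Proof.
move=> LD; have LA := deletion_sub LD.
have XR : (L :&: H)%VS \in restriction A H by apply/restrictionP; exists L.
have [c hc] : exists c, forall i, a L (lift ord0 i) = c * b (L :&: H)%VS i.
  apply: (lform_proportional (a := fun i => a L (lift ord0 i))) => v.
  have [u uH hu] := exists_coord_H v.
  have := mem_restriction XR uH; have := mem_hyperplane_H LA uH.
  under [in X in _ = (X == _)]eq_bigr do rewrite hu.
  move=> uL; under eq_bigr do rewrite hu.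
  by rewrite memv_cap uH andbT uL => E /eqP; rewrite -E => /eqP.
exists c => //; have [i ai] := abar_neq0 LD; apply: contra ai => /eqP c0.
by rewrite hc c0 mul0r.
Qed.

Lemma beta_neq0 X : X \in restriction A H -> beta X != 0.
Proof.
move=> XR; have /restrictionP[L LD XL] := XR.
have [c c0 hc] := alpha_beta LD; have [i ai] := abar_neq0 LD.
apply: contra ai => /eqP b0; rewrite hc -XL /b b0 mcoeff0 mulr0 //.
Qed.

Lemma alpha_neq0 L : L \in A -> alpha L != 0.
Proof. by move=> LA; rewrite (alpha_lform LA); case: (alpha_prime LA). Qed.

Lemma Qpoly_deletion : Qpoly A alpha = 'X_ord0 * Qpoly (deletion A H) alpha.
Proof. by rewrite /Qpoly (big_fsetD1 H HA) /= alphaH. Qed.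

Lemma Qpoly_lform : Qpoly (deletion A H) alpha =
  \prod_(L <- deletion A H) lform (a L).
Proof.
by rewrite /Qpoly big_seq [RHS]big_seq; apply: eq_bigr => L /deletion_sub/alpha_lform.
Qed.

Lemma x_ndvd_Qpoly : ~ mdvd 'X_ord0 (Qpoly (deletion A H) alpha).
Proof.
rewrite Qpoly_lform big_seq; apply: mprime_prod; first exact: x_prime.
move=> L LD; have := LD; rewrite in_deletion => /andP[LH LA].
rewrite -alphaH (alpha_lform HA); apply: alpha_ndvd => //.
by rewrite eq_sym.
Qed.

Variable p : nat.

Local Notation ls := (enum_fset (deletion A H)).
Local Notation xs := (enum_fset (restriction A H)).
Local Notation Q' := (Qpoly (deletion A H) alpha).
Local Notation OmA := (Omega A alpha p%:Z).
Local Notation OmD := (Omega (deletion A H) alpha p%:Z).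
Local Notation OmR := (Omega (restriction A H) beta (p%:Z - 1)).
Local Notation OmRB := (form_div OmR (Bbar A H alpha beta)).

Lemma OmegaD_numer w : OmD w <-> exists2 t, numD ls a p t & pfrac_map Q' t = w.
Proof.
apply: OmegaP => L /deletion_sub LA; last exact: alpha_neq0.
by have [] := alphaP LA.
Qed.

Lemma OmegaR_numer w : OmR w <->
  exists2 z, numR xs b p z & pfrac_map (Qpoly (restriction A H) beta) z = w.
Proof.
by apply: OmegaP => X XR; [have [] := betaP XR|apply: beta_neq0].
Qed.

Lemma numer_numA t : numer (fun L => L \in A) a p t <-> numA ls a p t.
Proof.
have eH : cst (a H) =1 cst (fun i => (i == ord0)%:R).
  by move=> i; rewrite /cst a_H.
split=> [[dt ht]|[[dt ht] hx]].
  split; first by split=> // L /deletion_sub; apply: ht.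
  move=> I; have := ht H HA I; rewrite -(alpha_lform HA) alphaH.
  by rewrite (eq_wed I eH (fun=> erefl)).
split=> // L LA I; have [->|LH] := eqVneq L H.
  rewrite -(alpha_lform HA) alphaH (eq_wed I eH (fun=> erefl)); exact: hx.
by apply: ht; rewrite -[_ \in _]/(L \in deletion A H) in_deletion LH.
Qed.

Lemma OmegaA_numer w : OmA w <->
  exists2 t, numA ls a p t & pfrac_map ('X_ord0 * Q') t = w.
Proof.
rewrite OmegaP; last exact: alpha_neq0; last by move=> L /alphaP[].
rewrite Qpoly_deletion.
by split=> -[t /numer_numA ht <-]; exists t.
Qed.

Lemma Qbar_neq0 : mred Q' != 0.
Proof. by apply/eqP => /mdvdx; apply: x_ndvd_Qpoly. Qed.

Lemma QR_neq0 : Qpoly (restriction A H) beta != 0.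
Proof.
rewrite /Qpoly big_seq; elim/big_ind: _ => [|f g|X XR].
- exact: oner_neq0.
- exact: mulf_neq0.
- exact: beta_neq0.
Qed.

(** Dividing by Bbar replaces the denominator Q(A^H) by the reduction of Q(A') and keeps the
    numerators. *)
Lemma OmegaRB_numer w : OmRB w <->
  exists2 z, numR xs b p z & pfrac_map (mred Q') z = w.
Proof.
have E z : pfrac_map (mred Q') z =
    [ffun I => pfrac_map (Qpoly (restriction A H) beta) z I / Bbar A H alpha beta].
  rewrite !pfrac_mapE; apply/ffunP => I; rewrite [LHS]ffunE [RHS]ffunE [X in _ = X / _]ffunE /Bbar.
  rewrite invf_div mulrA divfK //.
  by rewrite tofrac_eq0; apply: QR_neq0.
split=> [[eta /OmegaR_numer[z Rz <-] ->]|[z Rz <-]]; first by exists z.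
exists (pfrac_map (Qpoly (restriction A H) beta) z) => //.
by apply/OmegaR_numer; exists z.
Qed.

Lemma res_numA t : numA ls a p t ->
  res (pfrac_map ('X_ord0 * Q') t) = pfrac_map (mred Q') (rho t).
Proof.
rewrite !pfrac_mapE; move=> [_ /wed_e0_dvd h1]; exact: (res_pfrac x_ndvd_Qpoly h1).
Qed.

Lemma submod_linear_image (R : comNzRingType) (W W' : lmodType R)
    (f : {linear W -> W'}) (M : W -> Prop) (M' : W' -> Prop) :
  submod M -> (forall w, M' w <-> exists2 u, M u & f u = w) -> submod M'.
Proof.
move=> hM M'E; split; first by apply/M'E; exists 0; [case: hM|rewrite linear0].
move=> c _ _ /M'E[u Mu <-] /M'E[v Mv <-]; apply/M'E.
by exists (c *: u + v); [apply: hM.2|rewrite linearP].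
Qed.

Lemma OmegaA_submod : submod OmA.
Proof.
apply: (submod_linear_image (f := pfrac_map ('X_ord0 * Q')) _ OmegaA_numer).
exact: numA_submod.
Qed.

Lemma OmegaD_fin_gen : fin_gen OmD.
Proof.
have := fin_gen_image (pfrac_map Q') (numer_fin_gen (fun L => L \in ls) a p).
by apply: fin_gen_eq => w; rewrite OmegaD_numer.
Qed.

Lemma OmegaR_fin_gen : fin_gen OmR.
Proof.
have := fin_gen_image (pfrac_map (Qpoly (restriction A H) beta))
  (numer_fin_gen (fun X => X \in xs) b (p%:Z - 1)).
by apply: fin_gen_eq => w; rewrite OmegaR_numer.
Qed.

Lemma OmegaRB_fin_gen : fin_gen OmRB.
Proof.
have := fin_gen_image (pfrac_map (mred Q'))
  (numer_fin_gen (fun X => X \in xs) b (p%:Z - 1)).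
by apply: fin_gen_eq => w; rewrite OmegaRB_numer.
Qed.

(** Both modules are injective images of the same module of numerators. *)
Lemma pd_le_OmegaRB k : pd_le OmRB k <-> pd_le OmR k.
Proof.
have hR := numer_submod (fun X => X \in xs) b (p%:Z - 1).
have h1 := pd_le_inj (f := pfrac_map (mred Q')) k hR
  (fun u _ => pfrac_map_inj Qbar_neq0).
have h2 := pd_le_inj (f := pfrac_map (Qpoly (restriction A H) beta)) k hR
  (fun u _ => pfrac_map_inj QR_neq0).
split=> h.
  apply: pd_le_eq (h2.1 (h1.2 (pd_le_eq OmegaRB_numer h))) => w.
  by rewrite OmegaR_numer.
apply: pd_le_eq (h1.1 (h2.2 (pd_le_eq OmegaR_numer h))) => w.
by rewrite OmegaRB_numer.
Qed.

Let x0 : ('X_ord0 : {mpoly K[n.+1]}) != 0.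
Proof. by case: (x_prime K n). Qed.

Let Q'0 : 'X_ord0 * Q' != 0.
Proof.
rewrite mulf_neq0 ?x0 //; apply/eqP => Q0; apply: x_ndvd_Qpoly.
by rewrite Q0; apply: mdvd0.
Qed.

(** The graded argument is carried out on numerators, where homogeneous components are those of
    polynomials, and transported back. *)
Lemma OmegaA_projective_free : pd_le OmA 0 -> free_submod OmA.
Proof.
have E w : OmA w <-> exists2 t, numer (fun L => L \in A) a p t &
    pfrac_map ('X_ord0 * Q') t = w.
  by rewrite OmegaA_numer; split=> -[t /numer_numA ht <-]; exists t.
have hA := numer_submod (fun L => L \in A) a p.
have fgA := numer_fin_gen (fun L => L \in A) a p.
have h1 := pd_le_inj (f := pfrac_map ('X_ord0 * Q')) 0 hA
  (fun u _ => pfrac_map_inj Q'0).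
move=> h; have pA := h1.2 (pd_le_eq E h).
have fA := graded_projective_free (@numer_graded _ _ _ _ _ _) fgA pA.
apply: free_submod_eq (free_submod_image (fun u => pfrac_map_inj Q'0) fgA fA) => w.
by rewrite E.
Qed.

Lemma res_semilinear : semilinear_on (@mred K n) OmA (@res K n).
Proof.
exact: (semilinear_on_image (numA_submod ls a p) (@rho_semilinear _ _ _ ls a p)
  OmegaA_numer res_numA).
Qed.

Lemma res_ker u : OmD u <-> OmA u /\ res u = 0.
Proof.
have aD L (LD : L \in ls) : mprime (lform (a L)) := alpha_prime (deletion_sub LD).
have xD L : L \in ls -> ~ mdvd (lform (a L)) ('X_ord0 : {mpoly K[n.+1]}).
  rewrite -[_ \in ls]/(L \in deletion A H) in_deletion => /andP[LH LA].
  by rewrite -alphaH (alpha_lform HA); apply: alpha_ndvd.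
split=> [/OmegaD_numer[t Dt <-]|[/OmegaA_numer[t At <-]]].
  have [At rt] : numA ls a p ('X_ord0 *: t) /\ rho ('X_ord0 *: t) = 0.
    by apply/(rho_ker p aD xD); exists t.
  have E : pfrac_map ('X_ord0 * Q') ('X_ord0 *: t) = pfrac_map Q' t.
    by rewrite !pfrac_mapE pfracM.
  rewrite -E; split; first by apply/OmegaA_numer; exists ('X_ord0 *: t).
  by rewrite (res_numA At) rt linear0.
rewrite (res_numA At) => /(pfrac_map_inj Qbar_neq0) rt.
have [t' Dt' ->] := (rho_ker p aD xD t).1 (conj At rt).
apply/OmegaD_numer; exists t' => //.
by rewrite !pfrac_mapE pfracM.
Qed.

Lemma res_image : free_submod OmD ->
  forall y, OmRB y <-> exists2 u, OmA u & res u = y.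
Proof.
move=> fD.
have fD' : free_submod (numD ls a p).
  apply: (free_submod_preimage (f := pfrac_map Q')).
  - exact: numer_submod.
  - move=> u; apply: pfrac_map_inj.
    by apply/eqP => Q0; apply: x_ndvd_Qpoly; rewrite Q0; apply: mdvd0.
  - exact: numer_fin_gen.
  - by apply: free_submod_eq fD => w; rewrite OmegaD_numer.
have xsP X : reflect (exists2 L, L \in ls & X = (L :&: H)%VS) (X \in xs).
  exact: restrictionP.
have aD L (LD : L \in ls) : mprime (lform (a L)) := alpha_prime (deletion_sub LD).
have xD L : L \in ls -> ~ mdvd (lform (a L)) ('X_ord0 : {mpoly K[n.+1]}).
  rewrite -[_ \in ls]/(L \in deletion A H) in_deletion => /andP[LH LA].
  by rewrite -alphaH (alpha_lform HA); apply: alpha_ndvd.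
have Dx L : L \in ls -> ~ mdvd ('X_ord0 : {mpoly K[n.+1]}) (lform (a L)).
  rewrite -[_ \in ls]/(L \in deletion A H) in_deletion => /andP[LH LA].
  by rewrite -alphaH (alpha_lform HA); apply: alpha_ndvd => //; rewrite eq_sym.
have DD L L' (LD : L \in ls) (L'D : L' \in ls) :=
  alpha_ndvd (deletion_sub LD) (deletion_sub L'D).
move=> y; split=> [/OmegaRB_numer[z Rz <-]|[u /OmegaA_numer[t At <-] <-]].
  have [t At rt] := rho_surjective (fset_uniq _) xsP aD DD xD Dx alphabar_prime
    alphabar_ndvd alpha_beta fD' Rz.
  exists (pfrac_map ('X_ord0 * Q') t); first by apply/OmegaA_numer; exists t.
  by rewrite (res_numA At) rt.
apply/OmegaRB_numer; exists (rho t); last by rewrite (res_numA At).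
exact: (rho_numR xsP alpha_beta At).
Qed.

Lemma pd_le_OmegaA k : free_submod OmD -> pd_le OmA k.+1 <-> pd_le OmR k.
Proof.
move=> fD; have [q [j [jinj jM]]] := free_fin_basis fD OmegaD_fin_gen.
have x_reg (f : {mpoly K[n.+1]}) : 'X_ord0 * f = 0 -> f = 0.
  by move=> /eqP; rewrite mulf_eq0 (negPf x0) => /eqP.
rewrite -pd_le_OmegaRB.
apply: (pd_le_extension (@mliftK K n) (@mred_eq0P K n) x_reg
  (@noetherian_mpoly K n) (rho := @res K n) (j := j)); last exact: OmegaRB_fin_gen.
split.
- exact: OmegaA_submod.
- exact: res_semilinear.
- exact: res_image.
- by move=> m; rewrite -res_ker.
- exact: jinj.
Qed.

Lemma Omega_minimal_lift : free_submod OmD ->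
  exists (s : nat) (w : 'I_s -> rform K n.+1),
    [/\ forall i, OmA (w i), minimal_generators OmRB (fun i => res (w i))
      & forall w', OmA w' <-> exists2 u, OmD u &
          exists c : 'I_s -> {mpoly K[n.+1]}, w' = u + \sum_i c i *: w i].
Proof.
move=> fD; apply: (minimal_lift (@mliftK K n) OmegaA_submod res_semilinear (res_image fD)).
  exact: res_ker.
exact: OmegaRB_fin_gen.
Qed.

End ArrangementGeometry.

Theorem theorem5p4 (K : fieldType) (n p : nat)
    (A : {fset {vspace 'rV[K]_n.+1}}) (H : {vspace 'rV[K]_n.+1})
    (e : n.+1.-tuple 'rV[K]_n.+1)
    (alpha : {vspace 'rV[K]_n.+1} -> {mpoly K[n.+1]})
    (beta : {vspace 'rV[K]_n.+1} -> {mpoly K[n]}) :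
  (forall L, L \in A -> \dim L = n) ->
  H \in A ->
  (p <= n.+1)%N ->
  basis_of fullv e ->
  (forall L, L \in A ->
     defining_form fullv (fun v i => coord e i v) L (alpha L)) ->
  alpha H = 'X_ord0 ->
  (forall X, X \in restriction A H ->
     defining_form H (fun v i => coord e (lift ord0 i) v) X (beta X)) ->
  free_submod (Omega (deletion A H) alpha p%:Z) ->
  (~ free_submod (Omega A alpha p%:Z) ->
     (exists (s : nat) (w : 'I_s -> rform K n.+1),
        [/\ forall i, Omega A alpha p%:Z (w i),
            minimal_generators
              (form_div (Omega (restriction A H) beta (p%:Z - 1))
                 (Bbar A H alpha beta))
              (fun i => res (w i))
          & forall w', Omega A alpha p%:Z w' <->
              exists2 u, Omega (deletion A H) alpha p%:Z u
                & exists c : 'I_s -> {mpoly K[n.+1]},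
                    w' = u + \sum_i c i *: w i]) /\
     pd (Omega A alpha p%:Z) =
       omap succn (pd (Omega (restriction A H) beta (p%:Z - 1)))) /\
  (free_submod (Omega (restriction A H) beta (p%:Z - 1)) ->
     exists2 d, pd (Omega A alpha p%:Z) = Some d & (d <= 1)%N).
Proof.
move=> dimA HA _ eB alphaP alphaH betaP fD.
have pdE k := pd_le_OmegaA dimA HA eB alphaP alphaH betaP k fD.
have fA := OmegaA_projective_free dimA HA alphaP alphaH (p := p).
have fgR := OmegaR_fin_gen dimA HA eB alphaP alphaH betaP p.
set OA := Omega A alpha p%:Z in pdE fA *.
set OR := Omega (restriction A H) beta (p%:Z - 1) in pdE fgR *.
split=> [nfA|fR].
  split; first exact: (Omega_minimal_lift dimA HA eB alphaP alphaH betaP fD).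
  (* Length 0 would make Omega(A) projective, hence free; so every bound for it is a successor. *)
  have pdS k : pd_le OA k -> exists2 l, k = l.+1 & pd_le OR l.
    case: k => [/fA //|k /pdE pk]; by exists k.
  case: (pd OR) (pdP OR) => [d [pd1 pd2]|pdN]; case: (pd OA) (pdP OA) => [d' [pA1 pA2]|pAN].
  - have [l El /pd2 dl] := pdS _ pA1; rewrite /= El; congr (Some _.+1).
    apply/eqP; rewrite eqn_leq dl andbT -ltnS -El.
    exact/pA2/pdE.
  - by case: (pAN d.+1); apply/pdE.
  - by have [l _ /pdN] := pdS _ pA1.
  - by [].
have pR : pd_le OR 0 by apply: free_pd_le.
have pA : pd_le OA 1 by apply/pdE.
by case: (pd OA) (pdP OA) => [d [pd1 pd2]|/(_ _ pA) //]; exists d => //; apply: pd2.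
Qed.
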